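(* For every $n\ge 1$, the double Orlik--Solomon algebra $OS_2(n)$ and the double even Orlik--Solomon algebra $OS_2^+(n)$ satisfy $$\dim_{\mathbb{Q}} OS_2(n)=\dim_{\mathbb{Q}} OS_2^+(n)=(n+1)^{n-1}.$$
   Context: All algebras are unital, associative and over $\mathbb{Q}$. Super-commutative means $ab=(-1)^{|a||b|}ba$ for homogeneous $a,b$, where $|\cdot|$ is the parity; thus odd generators anticommute and even generators commute. The double Orlik--Solomon algebra $OS_2(n)$ is the super-commutative associative algebra with odd generators $x_{ij},y_{ij}$, $1\le i\ne j\le n$, and relations (for all $i\neq j$, respectively for all pairwise distinct $i,j,k\in\{1,\dots,n\}$) $$x_{ij}-x_{ji}=y_{ij}-y_{ji}=0,$$ $$x_{ij}x_{jk}+x_{jk}x_{ki}+x_{ki}x_{ij}=0,$$ $$x_{ij}y_{jk}+x_{jk}y_{ki}+x_{ki}y_{ij}+y_{ij}x_{jk}+y_{jk}x_{ki}+y_{ki}x_{ij}=0,$$ $$y_{ij}y_{jk}+y_{jk}y_{ki}+y_{ki}y_{ij}=0,$$ $$x_{ij}^2=x_{ij}y_{ij}=y_{ij}^2=0.$$ The double even Orlik--Solomon algebra $OS_2^+(n)$ is the super-commutative (hence commutative) associative algebra with even generators $x_{ij},y_{ij}$, $1\le i\ne j\le n$, and relations (for all $i\neq j$, respectively for all pairwise distinct $i,j,k$) $$x_{ij}+x_{ji}=y_{ij}+y_{ji}=0,$$ $$x_{ij}x_{jk}+x_{jk}x_{ki}+x_{ki}x_{ij}=0,$$ $$x_{ij}y_{jk}+x_{jk}y_{ki}+x_{ki}y_{ij}+y_{ij}x_{jk}+y_{jk}x_{ki}+y_{ki}x_{ij}=0,$$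 $$y_{ij}y_{jk}+y_{jk}y_{ki}+y_{ki}y_{ij}=0,$$ $$x_{ij}^2=x_{ij}y_{ij}=y_{ij}^2=0.$$ *)

(* Defs.v *)
From HB Require Import structures.
From mathcomp Require Import all_boot all_order all_algebra generic_quotient.
From mathcomp Require Import finmap monalg boolp.

Set Implicit Arguments.
Unset Strict Implicit.
Unset Printing Implicit Defensive.

Import GRing.Theory.
Local Open Scope ring_scope.
Local Open Scope quotient_scope.

(* The two-sided ideal of A generated by S. *)
Inductive ideal2 (A : pzRingType) (S : A -> Prop) : A -> Prop :=
| Ideal2_gen a of S a : ideal2 S a
| Ideal2_0 : ideal2 S 0
| Ideal2_add a b of ideal2 S a & ideal2 S b : ideal2 S (a + b)
| Ideal2_mull a b of ideal2 S b : ideal2 S (a * b)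
| Ideal2_mulr a b of ideal2 S a : ideal2 S (a * b).

(* [quotalg properS] is the quotient of A by [ideal2 S]. The properness proof
   is needed because every [algType] satisfies 1 != 0; ring_quotient only
   provides the ring structure for commutative rings. *)
Section QuotientAlgebra.
Variables (K : fieldType) (A : algType K) (S : A -> Prop).

Definition ideal2_pred : {pred A} := [pred a | `[< ideal2 S a >]].

Lemma ideal2P a : reflect (ideal2 S a) (a \in ideal2_pred).
Proof. exact: asboolP. Qed.

Fact ideal2_zmod_closed : zmod_closed ideal2_pred.
Proof.
split=> [|a b /ideal2P aI /ideal2P bI]; first exact/ideal2P/Ideal2_0.
by apply/ideal2P/Ideal2_add=> //; rewrite -mulN1r; apply: Ideal2_mull.
Qed.

HB.instance Definition _ :=
  GRing.isZmodClosed.Build A ideal2_pred ideal2_zmod_closed.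

Definition quotalg of ~ ideal2 S 1 : Type := (Quotient.quot ideal2_pred).

Hypothesis properS : ~ ideal2 S 1.
Local Notation Q := (quotalg properS).

HB.instance Definition _ := GRing.Zmodule.copy Q (Quotient.quot ideal2_pred).

Definition quotalg_pi (a : A) : Q := \pi_(Quotient.quot ideal2_pred) a.
Local Notation pi := quotalg_pi.
Definition quotalg_repr (q : Q) : A := repr (q : (Quotient.quot ideal2_pred)).
Local Notation rep := quotalg_repr.

Lemma quotalg_reprK q : pi (rep q) = q.
Proof. exact: reprK. Qed.

Lemma quotalg_piP a b : pi a = pi b <-> ideal2 S (a - b).
Proof.
split=> [/eqP|/ideal2P]; first by rewrite -Quotient.idealrBE => /ideal2P.
by rewrite Quotient.idealrBE => /eqP.
Qed.

Lemma quotalg_piD a b : pi (a + b) = pi a + pi b.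
Proof. exact: (raddfD (\pi_(Quotient.quot ideal2_pred))). Qed.

Definition quotalg_mul (p q : Q) : Q := pi (rep p * rep q).
Definition quotalg_scale (c : K) (q : Q) : Q := pi (c *: rep q).

Lemma ideal2_repr a : ideal2 S (rep (pi a) - a).
Proof. by apply/quotalg_piP; rewrite quotalg_reprK. Qed.

Lemma quotalg_piM a b : pi (a * b) = quotalg_mul (pi a) (pi b).
Proof.
apply/esym/quotalg_piP.
have -> : rep (pi a) * rep (pi b) - a * b
    = rep (pi a) * (rep (pi b) - b) + (rep (pi a) - a) * b.
  by rewrite mulrBr mulrBl addrA subrK.
by apply: Ideal2_add; [apply: Ideal2_mull|apply: Ideal2_mulr];
  apply: ideal2_repr.
Qed.

Lemma quotalg_piZ c a : pi (c *: a) = quotalg_scale c (pi a).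
Proof.
apply/esym/quotalg_piP; rewrite -scalerBr -mulr_algl.
exact/Ideal2_mull/ideal2_repr.
Qed.

Fact quotalg_mulA : associative quotalg_mul.
Proof.
move=> p q r; rewrite -[p]quotalg_reprK -[q]quotalg_reprK -[r]quotalg_reprK.
by rewrite -!quotalg_piM mulrA.
Qed.

Fact quotalg_mul1r : left_id (pi 1) quotalg_mul.
Proof. by move=> p; rewrite -[p]quotalg_reprK -quotalg_piM mul1r. Qed.

Fact quotalg_mulr1 : right_id (pi 1) quotalg_mul.
Proof. by move=> p; rewrite -[p]quotalg_reprK -quotalg_piM mulr1. Qed.

Fact quotalg_mulDl : left_distributive quotalg_mul +%R.
Proof.
move=> p q r; rewrite -[p]quotalg_reprK -[q]quotalg_reprK -[r]quotalg_reprK.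
by rewrite -quotalg_piD -!quotalg_piM mulrDl quotalg_piD.
Qed.

Fact quotalg_mulDr : right_distributive quotalg_mul +%R.
Proof.
move=> p q r; rewrite -[p]quotalg_reprK -[q]quotalg_reprK -[r]quotalg_reprK.
by rewrite -quotalg_piD -!quotalg_piM mulrDr quotalg_piD.
Qed.

Fact quotalg_oner_neq0 : pi 1 != 0.
Proof.
apply/eqP=> pi10; apply: properS; rewrite -[1]subr0; apply/quotalg_piP.
by rewrite pi10; apply/esym/(raddf0 (\pi_(Quotient.quot ideal2_pred))).
Qed.

HB.instance Definition _ := GRing.Zmodule_isNzRing.Build Q
  quotalg_mulA quotalg_mul1r quotalg_mulr1 quotalg_mulDl quotalg_mulDr
  quotalg_oner_neq0.

Fact quotalg_scaleA a b q :
  quotalg_scale a (quotalg_scale b q) = quotalg_scale (a * b) q.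
Proof. by rewrite -[q]quotalg_reprK -!quotalg_piZ scalerA. Qed.

Fact quotalg_scale1r : left_id 1 quotalg_scale.
Proof. by move=> q; rewrite -[q]quotalg_reprK -quotalg_piZ scale1r. Qed.

Fact quotalg_scaleDr : right_distributive quotalg_scale +%R.
Proof.
move=> c p q; rewrite -[p]quotalg_reprK -[q]quotalg_reprK.
by rewrite -quotalg_piD -!quotalg_piZ scalerDr quotalg_piD.
Qed.

Fact quotalg_scaleDl q : {morph quotalg_scale^~ q : a b / a + b}.
Proof.
move=> a b; rewrite -[q]quotalg_reprK -!quotalg_piZ.
by rewrite scalerDl quotalg_piD.
Qed.

HB.instance Definition _ := GRing.Zmodule_isLmodule.Build K Q
  quotalg_scaleA quotalg_scale1r quotalg_scaleDr quotalg_scaleDl.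

Fact quotalg_scaleAl c (p q : Q) : c *: (p * q) = (c *: p) * q.
Proof.
rewrite -[p]quotalg_reprK -[q]quotalg_reprK.
by rewrite /*%R/= /*:%R/= -quotalg_piM -!quotalg_piZ -quotalg_piM scalerAl.
Qed.

HB.instance Definition _ := GRing.Lmodule_isLalgebra.Build K Q quotalg_scaleAl.

Fact quotalg_scaleAr c (p q : Q) : c *: (p * q) = p * (c *: q).
Proof.
rewrite -[p]quotalg_reprK -[q]quotalg_reprK.
by rewrite /*%R/= /*:%R/= -quotalg_piM -!quotalg_piZ -quotalg_piM scalerAr.
Qed.

HB.instance Definition _ := GRing.Lalgebra_isAlgebra.Build K Q quotalg_scaleAr.

End QuotientAlgebra.

Section FreeAlgebra.
Variables (K : fieldType) (X : choiceType).

(* The free algebra K<X>, with basis the words in X. The alias carries the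
   [algType] structure, which monalg only provides for commutative monoids. *)
Definition freealg : Type := {malg K[{fmonom X}]}.

HB.instance Definition _ := GRing.Lalgebra.copy freealg {malg K[{fmonom X}]}.

Fact malg_scaleAr (M : monomType) c (f g : {malg K[M]}) :
  c *: (f * g) = f * (c *: g).
Proof.
apply/malgP=> w; rewrite mcoeffZ !(@mcoeffMlw _ _ (msupp f) (msupp g)) //;
  last exact: msuppZ_le.
rewrite mulr_sumr; apply: eq_bigr => u _; rewrite mulr_sumr.
by apply: eq_bigr => v _; rewrite mcoeffZ mulrnAr mulrCA.
Qed.

HB.instance Definition _ :=
  GRing.Lalgebra_isAlgebra.Build K freealg
    (@malg_scaleAr {fmonom X}).

Definition fgen (g : X) : freealg := << fmu g >>.

(* [par] gives the parity of the generators, [true] standing for odd. *)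
Variable par : X -> bool.

Definition word_parity (w : {fmonom X}) : bool := odd (count par w).

Definition homogeneous (p : bool) (f : freealg) : Prop :=
  forall w, w \in msupp f -> word_parity w = p.

Variant supercommutator : freealg -> Prop :=
| Supercommutator p q a b of homogeneous p a & homogeneous q b :
    supercommutator (a * b - (-1) ^+ (p && q) * (b * a)).

End FreeAlgebra.

Section DoubleOrlikSolomon.
Variable n : nat.

(* The generators x_ij ([false]) and y_ij ([true]) for ordered pairs i != j. *)
Definition OSgen : choiceType :=
  (bool * {ij : 'I_n * 'I_n | ij.1 != ij.2})%type.

Local Notation F := (freealg rat OSgen).

(* The junk value 0 for i = j occurs in none of the relations below. *)
Definition OSx (i j : 'I_n) : F :=
  if insub (i, j) is Some ij then fgen rat ((false, ij) : OSgen) else 0.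
Definition OSy (i j : 'I_n) : F :=
  if insub (i, j) is Some ij then fgen rat ((true, ij) : OSgen) else 0.

Local Notation x := OSx.
Local Notation y := OSy.

Variant symmetry_relation : F -> Prop :=
| Sym_x i j of i != j : symmetry_relation (x i j - x j i)
| Sym_y i j of i != j : symmetry_relation (y i j - y j i).

Variant antisymmetry_relation : F -> Prop :=
| Antisym_x i j of i != j : antisymmetry_relation (x i j + x j i)
| Antisym_y i j of i != j : antisymmetry_relation (y i j + y j i).

Variant OS_relation : F -> Prop :=
| OS_xxx i j k of uniq [:: i; j; k] :
    OS_relation (x i j * x j k + x j k * x k i + x k i * x i j)
| OS_xy i j k of uniq [:: i; j; k] :
    OS_relation (x i j * y j k + x j k * y k i + x k i * y i j
               + y i j * x j k + y j k * x k i + y k i * x i j)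
| OS_yyy i j k of uniq [:: i; j; k] :
    OS_relation (y i j * y j k + y j k * y k i + y k i * y i j)
| OS_sq_x i j of i != j : OS_relation (x i j ^+ 2)
| OS_mul_xy i j of i != j : OS_relation (x i j * y i j)
| OS_sq_y i j of i != j : OS_relation (y i j ^+ 2).

Definition OS2_relation (f : F) : Prop :=
  [\/ supercommutator (fun=> true) f, symmetry_relation f | OS_relation f].

Definition OS2p_relation (f : F) : Prop :=
  [\/ supercommutator (fun=> false) f, antisymmetry_relation f | OS_relation f].

(* Properness: every relation has constant coefficient 0. *)
Definition aug (f : F) : rat := @mcoeff {fmonom OSgen} rat (@mone _) f.

Lemma aug0 : aug 0 = 0. Proof. exact: mcoeff0. Qed.
Lemma aug1 : aug 1 = 1. Proof. exact: (mcoeff1g_is_multiplicative _ _).2. Qed.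
Lemma augD f g : aug (f + g) = aug f + aug g. Proof. exact: mcoeffD. Qed.
Lemma augN f : aug (- f) = - aug f. Proof. exact: mcoeffN. Qed.
Lemma augM f g : aug (f * g) = aug f * aug g.
Proof. exact: (mcoeff1g_is_multiplicative _ _).1. Qed.

Lemma aug_OSx i j : aug (x i j) = 0.
Proof.
rewrite /OSx; case: insubP => [ij _ _|_]; last exact: aug0.
by rewrite /aug /fgen mcoeffU fm1_eq1.
Qed.

Lemma aug_OSy i j : aug (y i j) = 0.
Proof.
rewrite /OSy; case: insubP => [ij _ _|_]; last exact: aug0.
by rewrite /aug /fgen mcoeffU fm1_eq1.
Qed.

Lemma signed_commutator0 (A : pzRingType) (R : comPzRingType) (h : A -> R)
    (a b : A) (s : bool) :
    {morph h : u v / u + v} -> {morph h : u / - u} ->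
    {morph h : u v / u * v} -> h 1 = 1 -> (s -> h a = 0) ->
  h (a * b - (-1) ^+ s * (b * a)) = 0.
Proof.
move=> hD hN hM h1; rewrite hD hN !hM; case: s => [->|_] //.
  by rewrite mul0r !mulr0 subrr.
by rewrite h1 mul1r mulrC subrr.
Qed.

Lemma aug_supercommutator par f : supercommutator par f -> aug f = 0.
Proof.
have homog1 a : homogeneous par true a -> aug a = 0.
  move=> ha; apply/eqP; rewrite mcoeff_eq0; apply/negP => /ha.
  by rewrite /word_parity fm1.
case=> p q a b ha _; apply: signed_commutator0 augD augN augM aug1 _ => /andP[].
by move=> p1 _; apply: homog1; rewrite -p1.
Qed.

Lemma aug_OS_relation f :
  [\/ symmetry_relation f, antisymmetry_relation f | OS_relation f] ->
  aug f = 0.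
Proof.
have a0M u v : aug u = 0 -> aug (u * v) = 0 by move=> u0; rewrite augM u0 mul0r.
have a0D u v : aug u = 0 -> aug v = 0 -> aug (u + v) = 0.
  by move=> u0 v0; rewrite augD u0 v0 addr0.
have a0N u : aug u = 0 -> aug (- u) = 0 by move=> u0; rewrite augN u0 oppr0.
case=> -[] *; repeat lazymatch goal with
  | |- aug (_ + _) = _ => apply a0D
  | |- aug (- _) = _ => apply a0N
  | |- aug (_ * _) = _ => apply a0M
  | |- aug (_ ^+ 2) = _ => apply a0M
  | |- aug (x _ _) = _ => exact: aug_OSx
  | |- aug (y _ _) = _ => exact: aug_OSy
  end.
Qed.

Lemma proper_of_aug (S : F -> Prop) :
  (forall f, S f -> aug f = 0) -> ~ ideal2 S 1.
Proof.
move=> augS; suff aug_eq0 f : ideal2 S f -> aug f = 0.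
  by move=> /aug_eq0 /eqP; rewrite aug1 oner_eq0.
elim=> {f} [f /augS //||f g _ f0 _ g0|f g _ g0|f g _ f0]; first exact: aug0.
- by rewrite augD f0 g0 addr0.
- by rewrite augM g0 mulr0.
- by rewrite augM f0 mul0r.
Qed.

Lemma OS2_proper : ~ ideal2 OS2_relation 1.
Proof.
apply: proper_of_aug => f [/aug_supercommutator//|fR|fR];
  apply: aug_OS_relation; by [apply: Or31|apply: Or33].
Qed.

Lemma OS2p_proper : ~ ideal2 OS2p_relation 1.
Proof.
apply: proper_of_aug => f [/aug_supercommutator//|fR|fR];
  apply: aug_OS_relation; by [apply: Or32|apply: Or33].
Qed.

Definition OS2 : algType rat := quotalg OS2_proper.
Definition OS2p : algType rat := quotalg OS2p_proper.

End DoubleOrlikSolomon.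

(* dim_K V = d, in the sense of the library's [vectType]: a linear bijection
   from V onto K^d. *)
Definition has_dim (K : fieldType) (V : lmodType K) (d : nat) : Prop :=
  inhabited (Vector.axiom d V).

(* Main.v *)
Require Import Defs.
From HB Require Import structures.
From mathcomp Require Import all_boot all_algebra.
From mathcomp Require Import finmap monalg boolp zify ring.

(**
Give vertex i the colour i and put w_t(i,j) = x_ij + t y_ij and
e_ij = w_i(i,j), so that e_ij and e_ji together span x_ij and y_ij.
For a rooted forest f on the vertices, given by its partial parent function,
let m_f be the product of the e_(i,f i).  The m_f form a basis.

They span: two edges of the same colour leaving i satisfy
w_t(i,j) w_t(i,k) = +-w_t(j,k) (w_t(i,j) - w_t(i,k)), so in w(a,b) m_f, when a
has parent k in f, the extra edge ab can be replaced by kb, which is closer to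
the roots, at the price of moving a below b in one of the terms.

They are independent: contracting the pair {i,j} and extracting the
coefficient of that pair along a functional vanishing on e_ji maps m_f to
m_(f/ij) if f i = j and to 0 otherwise.  If i is a leaf of f, then f is the
forest with fewest internal vertices among those containing the edge from i to
j and having the same contraction.

Forests with k edges are counted by adding one edge at a time:
(k+1) F_(k+1) = n (n-1-k) F_k, hence F_k = 'C(n-1,k) n^k.
*)

Set Implicit Arguments.
Unset Strict Implicit.
Unset Printing Implicit Defensive.

Import GRing.Theory Num.Theory.
Local Open Scope ring_scope.

(** * Rooted forests as partial parent functions *)

Section Forests.
Variable T : finType.
Implicit Types (f g : {ffun T -> option T}) (h : T -> nat) (a b i j u v : T).

Definition reparent f a (o : option T) : {ffun T -> option T} :=
  [ffun v => if v == a then o else f v].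

(** Acyclicity is certified by a rank that drops along every edge; the same ranks later measure the
    progress of straightening. *)
Definition ranked f h := forall v u, f v = Some u -> (h u < h v)%N.

Definition forest f : bool := `[< exists h, ranked f h >].

Definition num_edges f := #|[set v | f v]|.

Definition parent_rel f : rel T := fun v u => f v == Some u.

Definition descends f : rel T := connect (parent_rel f).

Lemma reparentE f a o v : reparent f a o v = if v == a then o else f v.
Proof. exact: ffunE. Qed.

Lemma reparent_id f a : reparent f a (f a) = f.
Proof. by apply/ffunP=> v; rewrite ffunE; case: eqP => [->|]. Qed.

Lemma reparentK f a o o' : reparent (reparent f a o) a o' = reparent f a o'.
Proof. by apply/ffunP=> v; rewrite !ffunE; case: eqP. Qed.

Lemma ranked_reparent_None f h a : ranked f h -> ranked (reparent f a None) h.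
Proof. by move=> fh v u; rewrite ffunE; case: eqP => // _ /fh. Qed.

Lemma forest_reparent_None f a : forest f -> forest (reparent f a None).
Proof.
by case/asboolP=> h fh; apply/asboolP; exists h; apply: ranked_reparent_None.
Qed.

Lemma forest_neq f u v : forest f -> f u = Some v -> u != v.
Proof. by case/asboolP=> h fh /fh; apply: contraTneq => ->; rewrite ltnn. Qed.

Lemma descends_step f v u a : f v = Some u -> v != a ->
  descends f v a = descends f u a.
Proof.
move=> fv va; apply/idP/idP => [/connectP[[|w p]] /=|]; last first.
  by apply: connect_trans; apply: connect1; rewrite /parent_rel fv.
- by rewrite /parent_rel fv => /andP[/eqP[<-] pw] ->; apply/connectP; exists p.
- by move=> _ av; rewrite av eqxx in va.
Qed.

Lemma descends_root f v a : f v = None -> descends f v a = (v == a).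
Proof.
move=> fv; apply/idP/eqP => [/connectP[[|w p]] //=|->]; last exact: connect0.
by rewrite /parent_rel fv.
Qed.

Lemma ranked_descends f h v a : ranked f h -> descends f v a -> (h a <= h v)%N.
Proof.
move=> fh /connectP[p + ->]; elim: p v => //= u p IHp v /andP[/eqP/fh hu /IHp].
by move/leq_trans; apply; apply: ltnW.
Qed.

(** Raising the whole subtree of [a] by [(h b).+1] lifts [a] above [b]; ranks outside the subtree
    are kept, as the straightening induction requires. *)
Lemma ranked_reparent f h a b : f a = None -> ranked f h ->
  ~~ descends f b a ->
  exists2 h', ranked (reparent f a (Some b)) h' &
    forall v, ~~ descends f v a -> h' v = h v.
Proof.
move=> fa fh ba;
exists (fun v => h v + (if descends f v a then (h b).+1 else 0))%N.
  move=> v u; rewrite ffunE; case: (eqVneq v a) => [-> [<-]|va fv].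
    by rewrite (negPf ba) addn0 /descends connect0 addnS ltnS leq_addl.
  by rewrite (descends_step fv va) ltn_add2r; apply: fh.
by move=> v /negPf->; rewrite addn0.
Qed.

Lemma forest_reparent f a b : forest f -> f a = None ->
  forest (reparent f a (Some b)) = ~~ descends f b a.
Proof.
case/asboolP=> h fh fa; apply/asboolP/idP=> [[k gk]|ba]; last first.
  by have [h' ? _] := ranked_reparent fa fh ba; exists h'.
(* A path from [b] up to [a] uses no edge leaving [a], since [f a = None]; it survives the grafting
   and closes a cycle with the new edge. *)
apply/negP=> /connectP[p pp al].
suff /(ranked_descends gk) : descends (reparent f a (Some b)) b a.
  by rewrite leqNgt (gk a b) // ffunE eqxx.
apply/connectP; exists p => //; apply: sub_path pp => v u /eqP fv.
by rewrite /parent_rel ffunE fv; case: (eqVneq v a) fv => // ->; rewrite fa.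
Qed.

Lemma num_edges_reparent f a b : f a = None ->
  num_edges (reparent f a (Some b)) = (num_edges f).+1.
Proof.
move=> fa; rewrite /num_edges (cardsD1 a) inE ffunE eqxx /= add1n; congr _.+1.
by apply: eq_card => v; rewrite !inE ffunE; case: eqP => [->|_]; rewrite ?fa.
Qed.

Lemma num_edges_reparent_None f a b : f a = Some b ->
  num_edges f = (num_edges (reparent f a None)).+1.
Proof.
move=> fa; rewrite -{1}[f](reparent_id f a) fa -[in LHS](reparentK f a None).
by rewrite num_edges_reparent // ffunE eqxx.
Qed.

Lemma num_edges_eq0 f : (num_edges f == 0%N) = (f == [ffun=> None]).
Proof.
rewrite cards_eq0; apply/eqP/eqP => [f0|->]; last first.
  by apply/setP=> v; rewrite !inE ffunE.
apply/ffunP=> v; rewrite ffunE.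
by have := in_set0 v; rewrite -f0 inE; case: (f v).
Qed.

Lemma forest0 : forest [ffun=> None].
Proof. by apply/asboolP; exists (fun=> 0%N) => v u; rewrite ffunE. Qed.

Definition leaf f i := [forall v, f v != Some i].

(** Among the vertices that have a parent, one of maximal rank has no child. *)
Lemma forest_leaf f : forest f -> (0 < num_edges f)%N ->
  exists i j, f i = Some j /\ leaf f i.
Proof.
case/asboolP=> h fh /card_gt0P[v0]; rewrite inE => fv0.
have [i fi hi] := arg_maxnP (P := fun v => f v : bool) h fv0.
case fij: (f i) fi => [j|] // _; exists i, j; split=> //.
apply/forallP=> v; apply/eqP=> fv.
by have := hi v; rewrite fv => /(_ isT); rewrite /= leqNgt fh.
Qed.

(** Moving from [j] to its parent keeps the root above it, so induction on the rank ends at that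
    root. *)
Lemma card_root_of f j : forest f ->
  #|[set i | (f i == None) && descends f j i]| = 1%N.
Proof.
case/asboolP=> h fh; have [m] := ubnP (h j); elim: m j => // m IH j /ltnSE hj.
case fj: (f j) => [u|].
  rewrite -(IH u (leq_trans (fh _ _ fj) hj)); apply: eq_card => i; rewrite !inE.
  case: eqP => //= fi; apply: (descends_step fj).
  by apply/eqP=> ji; move: fj; rewrite ji fi.
rewrite -(cards1 j); apply: eq_card => i;
  rewrite !inE descends_root // (eq_sym j).
by apply: andb_idl => /eqP->; rewrite fj.
Qed.

(** * Counting rooted forests by number of edges *)

Definition forests k := [set f | forest f & num_edges f == k].

Lemma card_pairs (A B : finType) (P : A -> B -> bool) :
  #|[set x : A * B | P x.1 x.2]| = (\sum_a #|[set b | P a b]|)%N.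
Proof.
rewrite -sum1_card (eq_bigl (fun x : A * B => P x.1 x.2)) => [|x];
  last by rewrite inE.
rewrite -(pair_big_dep predT P (fun _ _ => 1%N)) /=.
by apply: eq_bigr => a _; rewrite sum1_card; apply: eq_card => b; rewrite inE.
Qed.

(** Among the pairs of a root and a vertex, each vertex excludes exactly one, the pair with its own
    root; there are [#|T| - num_edges f] roots. *)
Lemma card_graftings f : forest f ->
  #|[set ij : T * T | (f ij.1 == None) && ~~ descends f ij.2 ij.1]|
    = (#|T| * (#|T| - (num_edges f).+1))%N.
Proof.
move=> ff; rewrite subnS -subn1 mulnBr muln1 mulnBr.
set A := [set _ | _].
set B := [set ij : T * T | (f ij.1 == None) && descends f ij.2 ij.1].
have cardB : #|B| = #|T|.
  transitivity #|[set ji : T * T | (f ji.2 == None) && descends f ji.1 ji.2]|.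
    rewrite -(card_imset B (f := fun ij => (ij.2, ij.1))) =>
      [|[a b] [c d] [-> ->] //].
    apply: eq_card => -[a b]; apply/imsetP/idP; rewrite !inE /=.
      by case=> -[c d]; rewrite inE /= => ? [-> ->].
    by exists (b, a); rewrite ?inE.
  rewrite (card_pairs (fun j i => (f i == None) && descends f j i)).
  rewrite (eq_bigr (fun=> 1%N)) ?sum1_card // => j _.
  exact: card_root_of.
have <- : (#|A| + #|B| = #|T| * #|T| - #|T| * num_edges f)%N; last first.
  by rewrite cardB addnK.
rewrite -mulnBr -cardsUI (_ : A :&: B = set0) ?cards0 ?addn0; last first.
  by apply/setP=> -[a b]; rewrite !inE /=;
    case: eqP (descends _ _ _) => [_|_] [].
rewrite (_ : A :|: B = setX [set i | f i == None] [set: T]); last first.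
  by apply/setP=> -[a b]; rewrite !inE /=;
    case: eqP (descends _ _ _) => [_|_] [].
rewrite cardsX cardsT mulnC; congr (_ * _)%N.
rewrite -(cardsC [set v | isSome (f v)]) addKn.
by apply: eq_card => v; rewrite !inE; case: (f v).
Qed.

(** Double counting: cutting a marked edge of a forest with [k.+1] edges leaves a forest with [k]
    edges and an admissible grafting. *)
Lemma card_forestsS k :
  (k.+1 * #|forests k.+1| = #|T| * (#|T| - k.+1) * #|forests k|)%N.
Proof.
pose A := [set x : {ffun T -> option T} * (T * T) |
  (x.1 \in forests k) && ((x.1 x.2.1 == None) && ~~ descends x.1 x.2.2 x.2.1)].
pose B := [set y : {ffun T -> option T} * T |
  (y.1 \in forests k.+1) && y.1 y.2].
have cardA : #|A| = (#|T| * (#|T| - k.+1) * #|forests k|)%N.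
  rewrite (card_pairs (fun f ij => (f \in forests k) &&
    ((f ij.1 == None) && ~~ descends f ij.2 ij.1))).
  rewrite (bigID (mem (forests k))) /= [X in (_ + X)%N]big1 ?addn0 =>
    [|f /negPf fk].
    rewrite [RHS]mulnC -[RHS]sum_nat_const; apply: eq_bigr => f fk.
    have/andP[ff /eqP fe] : forest f && (num_edges f == k) by rewrite inE in fk.
    rewrite -fe -card_graftings // fe.
    by apply: eq_card => ij; rewrite [LHS]in_set [RHS]in_set fk.
  by apply: eq_card0 => ij; rewrite in_set fk.
have cardB : #|B| = (k.+1 * #|forests k.+1|)%N.
  rewrite (card_pairs (fun f i => (f \in forests k.+1) && f i)).
  rewrite (bigID (mem (forests k.+1))) /= [X in (_ + X)%N]big1 ?addn0 =>
    [|f /negPf fk].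
    rewrite [RHS]mulnC -[RHS]sum_nat_const; apply: eq_bigr => f fk.
    have/andP[_ /eqP fe] : forest f && (num_edges f == k.+1).
      by rewrite inE in fk.
    by rewrite -[RHS]fe; apply: eq_card => i;
      rewrite [LHS]in_set [RHS]in_set fk.
  by apply: eq_card0 => i; rewrite in_set fk.
rewrite -cardA -cardB; symmetry.
pose graft (x : {ffun T -> option T} * (T * T)) :=
  (reparent x.1 x.2.1 (Some x.2.2), x.2.1).
(* Before grafting [i] was a root, so removing its parent recovers the forest. *)
rewrite -(card_in_imset (f := graft)); last first.
  move=> [f [i j]] [f' [i' j']]; rewrite !inE /= => /andP[_ /andP[/eqP fi _]].
  move=> /andP[_ /andP[/eqP fi' _]] [ff' ii']; rewrite -{}ii' in ff' fi' *.
  have [->] : Some j = Some j' by have /ffunP/(_ i) := ff'; rewrite !ffunE eqxx.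
  by rewrite -[f](reparent_id f i) -[f'](reparent_id f' i) fi fi'
    -(reparentK f i (Some j)) ff' reparentK.
apply: eq_card => -[g i]; apply/imsetP/idP.
  case=> -[f [a b]]; rewrite !inE /=
    => /andP[/andP[ff /eqP <-] /andP[/eqP fa ba]] [-> ->].
  by rewrite forest_reparent // ba num_edges_reparent // eqxx ffunE eqxx.
rewrite !inE /= => /andP[/andP[gf /eqP gk]]; case gi: (g i) => [j|] // _.
exists (reparent g i None, (i, j)); last first.
  by rewrite /graft /= reparentK -gi reparent_id.
rewrite !inE /= forest_reparent_None //= ffunE eqxx eqxx /=.
rewrite -forest_reparent ?ffunE ?eqxx //; last exact: forest_reparent_None.
by rewrite reparentK -gi reparent_id gf -eqSS -(num_edges_reparent_None gi) gk
  eqxx.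
Qed.

Lemma card_forests_edges k : #|forests k| = ('C(#|T|.-1, k) * #|T| ^ k)%N.
Proof.
elim: k => [|k IHk].
  rewrite bin0 expn0 mul1n -(cards1 ([ffun=> None] : {ffun T -> option T})).
  apply: eq_card => f; rewrite !inE num_edges_eq0.
  by apply: andb_idl => /eqP->; apply: forest0.
apply/eqP; rewrite -(eqn_pmul2l (ltn0Sn k)) card_forestsS IHk.
rewrite [X in _ == X]mulnA mul_bin_left expnS -subn1 -subnDA add1n.
by apply/eqP; nia.
Qed.

Lemma card_forests : (0 < #|T|)%N ->
  #|[set f | forest f]| = (#|T|.+1 ^ #|T|.-1)%N.
Proof.
move=> T_gt0; rewrite -addn1 addnC expnDn prednK //.
(* The bound is read off from the vanishing of ['C(#|T|.-1, k)] for [k >= #|T|]. *)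
have edges_lt f : f \in [set f | forest f] -> (num_edges f < #|T|)%N.
  rewrite inE => ff; rewrite ltnNge; apply/negP=> lef.
  have : (0 < #|forests (num_edges f)|)%N.
    by apply/card_gt0P; exists f; rewrite inE ff eqxx.
  by rewrite card_forests_edges bin_small ?prednK.
rewrite -sum1_card.
(* By [edges_lt], the default [Ordinal T_gt0] is never taken on a forest. *)
rewrite (partition_big (fun f => insubd (Ordinal T_gt0) (num_edges f)) predT)
  //=.
apply: eq_bigr => k _; rewrite exp1n mul1n -card_forests_edges sum1_card.
apply: eq_card => f; rewrite [RHS]inE unfold_in.
case: (boolP (f \in _)) => [ff|]; last by rewrite inE => /negPf->.
move: (ff); rewrite inE => -> /=.
by rewrite -val_eqE val_insubd edges_lt.
Qed.

End Forests.

(** * Double Orlik-Solomon families and forest monomials *)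

Lemma add_self_eq0 (V : lmodType rat) (v : V) : v + v = 0 -> v = 0.
Proof.
by move=> /eqP; rewrite -mulr2n -scaler_nat scaler_eq0 => /orP[|/eqP].
Qed.

Definition eq_upto_sign (R : pzRingType) (u v : R) :=
  exists s : bool, u = (-1) ^+ s * v.

(** Each factor passed on the way to the front costs a sign. [F'] is [F] with the factor at [a]
    replaced by 1, which keeps the index list unchanged. *)
Lemma prod_pull (R : pzRingType) (I : eqType) (r : seq I) (a : I)
    (F F' : I -> R) :
  uniq r -> a \in r -> F' a = 1 -> (forall v, v != a -> F' v = F v) ->
  (forall v, eq_upto_sign (F v * F a) (F a * F v)) ->
  eq_upto_sign (\prod_(v <- r) F v) (F a * \prod_(v <- r) F' v).
Proof.
move=> + + F'a F'F FC; elim: r => // v r IHr /= /andP[vr ur].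
rewrite !big_cons inE; have [av|va /= ar] := eqVneq a v.
  rewrite -{}av in vr * => _; exists false; rewrite F'a !mul1r; congr (_ * _).
  rewrite !big_seq; apply: eq_bigr => u r_u; rewrite F'F //.
  by apply: contraTneq r_u => ->.
have [s ->] := IHr ur ar; have [t Ft] := FC v.
exists (s (+) t); rewrite F'F 1?eq_sym // signr_addb [LHS]mulrA commr_sign
  -!mulrA.
by rewrite [F v * (F a * _)]mulrA Ft -!mulrA.
Qed.

Section Configurations.
Variables (n : nat) (par : bool).
Implicit Types (i j k : 'I_n) (c d : bool) (f g : {ffun 'I_n -> option 'I_n}).

Definition triangle (R : pzRingType) (z : bool -> 'I_n -> 'I_n -> R)
    c d i j k :=
  z c i j * z d j k + z c j k * z d k i + z c k i * z d i j.

(* [os_triangle] gives twice the triangle relation when c = d, and [os_comm]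
   includes the indices i = j, where [OSx] and [OSy] are 0. *)
Record os_family (R : pzRingType) (z : bool -> 'I_n -> 'I_n -> R) : Prop :=
  OSFamily {
    os_sym : forall c i j, i != j -> z c j i = - ((-1) ^+ par * z c i j);
    os_comm : forall c d i j k l,
      z c i j * z d k l = (-1) ^+ par * (z d k l * z c i j);
    os_triangle : forall c d i j k, uniq [:: i; j; k] ->
      triangle z c d i j k + triangle z d c i j k = 0;
    os_sq : forall c d i j, i != j -> z c i j * z d i j = 0 }.

(* The member x + t y of the pencil spanned by x and y; [forest_monomial] uses
   t = i on the edge from i to its parent. *)
Definition tinted (R : pzRingType) (z : bool -> 'I_n -> 'I_n -> R)
    (t : nat) i j :=
  z false i j + z true i j *+ t.

Definition forest_monomial (R : pzRingType) (z : bool -> 'I_n -> 'I_n -> R)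
    (f : {ffun 'I_n -> option 'I_n}) : R :=
  \prod_i (if f i is Some j then tinted z i i j else 1).

Section Tinted.
Variables (R : pzRingType) (z : bool -> 'I_n -> 'I_n -> R).
Hypothesis zP : os_family z.
Local Notation w := (tinted z).
Local Notation sg := ((-1) ^+ par : R).

Lemma tinted_sym t i j : i != j -> w t j i = - (sg * w t i j).
Proof.
by move=> ij; rewrite /tinted !(os_sym zP _ ij) mulrDr opprD mulrnAr mulNrn.
Qed.

Lemma tinted_comm t u i j k l : w t i j * w u k l = sg * (w u k l * w t i j).
Proof.
rewrite /tinted !(mulrDl, mulrDr, mulrnAl, mulrnAr) !(os_comm zP _ _ i j k l).
by rewrite addrACA [_ *+ u *+ t]mulrnAC.
Qed.

Lemma tinted_sq t u i j : i != j -> w t i j * w u i j = 0.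
Proof.
move=> ij; rewrite /tinted !mulrDl !mulrDr !mulrnAl !mulrnAr !(os_sq zP) //.
by rewrite !mul0rn !addr0.
Qed.

Lemma forest_monomial_reparent f i j :
  eq_upto_sign (forest_monomial z (reparent f i (Some j)))
    (w i i j * forest_monomial z (reparent f i None)).
Proof.
rewrite /forest_monomial.
have [|||v|s ->] := prod_pull (a := i)
  (F := fun v => if reparent f i (Some j) v is Some u then w v v u else 1)
  (F' := fun v => if reparent f i None v is Some u then w v v u else 1)
  (index_enum_uniq 'I_n).
- exact: mem_index_enum.
- by rewrite reparentE eqxx.
- by move=> v /negPf vi; rewrite !reparentE vi.
- rewrite [reparent f i _ i]reparentE eqxx.
  case: (reparent _ _ _ v) => [u|]; first by exists par; apply: tinted_comm.
  by exists false; rewrite !mul1r mulr1.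
by exists s; rewrite [reparent f i _ i]reparentE eqxx.
Qed.

End Tinted.

(** * Forest monomials span: cycles vanish, extra edges are straightened *)

Section Spanning.
Variables (R : algType rat) (z : bool -> 'I_n -> 'I_n -> R).
Hypothesis zP : os_family z.
Local Notation w := (tinted z).
Local Notation mono := (forest_monomial z).
Local Notation sg := ((-1) ^+ par : R).

(** The coefficients of 1, t and t^2 are the xx, the mixed and the yy triangle relations. *)
Lemma tinted_triangle t i j k : uniq [:: i; j; k] ->
  w t i j * w t j k + w t j k * w t k i + w t k i * w t i j = 0.
Proof.
move=> u; have zz c : triangle z c c i j k = 0.
  by apply: add_self_eq0; apply: (os_triangle zP).
transitivity (triangle z false false i j k
  + (triangle z false true i j k + triangle z true false i j k) *+ t
  + triangle z true true i j k *+ t *+ t).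
  rewrite /tinted /triangle !(mulrDl, mulrDr, mulrnAl, mulrnAr, mulrnDl).
  by rewrite [LHS](AC ((2*2)*(2*2)*(2*2))
    ((1*5*9)*((2*6*10)*(3*7*11))*(4*8*12))).
by rewrite !zz (os_triangle zP) // !mul0rn !addr0.
Qed.

Lemma sign_cases : sg = 1 \/ sg = -1.
Proof. by case: par; [right; apply: expr1|left; apply: expr0]. Qed.

(** The triangle relation, solved so that a two-edge path through [j] is traded for terms containing
    the chord from [i] to [k]. *)
Lemma tinted_exchange t i j k : uniq [:: i; j; k] ->
  w t i j * w t j k = (w t i j + sg * w t j k) * w t i k.
Proof.
move=> u; have ik : i != k.
  by move: u => /= /andP[]; rewrite !inE negb_or => /andP[].
have /eqP := tinted_triangle t u; rewrite -addrA addr_eq0 => /eqP ->.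
rewrite (tinted_comm zP t t k i i j) (tinted_sym zP t ik).
move: (w t i j) (w t j k) (w t i k) => x y v.
case: sign_cases => ->;
  rewrite !(mul1r, mulN1r, opprK, mulrN, mulNr, mulrDl) opprD.
  by rewrite !opprK addrC.
by rewrite opprK addrC.
Qed.

(** This is the exchange for the path j, i, k after turning the edge ij around. *)
Lemma tinted_fork t i j k : uniq [:: i; j; k] ->
  w t i j * w t i k = sg * (w t j k * (w t i j - w t i k)).
Proof.
move=> u; have [ij u'] : i != j /\ uniq [:: j; i; k].
  move: u; rewrite /= !inE !negb_or -!andbA [j == i]eq_sym.
  by move=> /and4P[-> -> ->].
have ji : j != i by rewrite eq_sym.
rewrite mulrBr mulrBr -!(tinted_comm zP) (tinted_sym zP t ji) mulNr -mulrA.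
rewrite tinted_exchange // (tinted_sym zP t ij).
move: (w t i j) (w t j k) (w t i k) => x y v.
case: sign_cases => ->;
  rewrite !(mul1r, mulN1r, opprK, mulrN, mulNr, mulrDl, opprD) //; exact: addrC.
Qed.

(** Linear interpolation in the colour; the coefficients do not depend on the edge, so two colours
    suffice to reach the whole pencil. *)
Lemma tinted_interp t u v : u != v -> exists a b : rat,
  forall i j, w t i j = a *: w u i j + b *: w v i j.
Proof.
move=> uv; have uv0 : u%:R - v%:R != 0 :> rat by rewrite subr_eq0 eqr_nat.
pose a : rat := (t%:R - v%:R) / (u%:R - v%:R).
pose b : rat := (u%:R - t%:R) / (u%:R - v%:R).
have ab1 : a + b = 1 by rewrite /a /b; field.
have abt : a * u%:R + b * v%:R = t%:R by rewrite /a /b; field.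
exists a, b => i j; rewrite /tinted -!(scaler_nat _ (z true i j)).
by rewrite !scalerDr !scalerA addrACA -!scalerDl ab1 abt scale1r.
Qed.

Lemma mul_upto_sign_eq0 (u v r : R) : eq_upto_sign u v -> r * v = 0 ->
  r * u = 0.
Proof. by case=> s -> rv0; rewrite mulrA commr_sign -mulrA rv0 mulr0. Qed.

Lemma forest_monomial_edge f i j : f i = Some j ->
  eq_upto_sign (mono f) (w i i j * mono (reparent f i None)).
Proof.
by move=> fi; rewrite -{1}(reparent_id f i) fi; apply: forest_monomial_reparent.
Qed.

Lemma path_avoid f (c : 'I_n) (q : seq 'I_n) x :
  path (parent_rel f) c q -> x \notin belast c q ->
  path (parent_rel (reparent f x None)) c q.
Proof.
elim: q c => //= d q IHq c /andP[cd dq]; rewrite inE negb_or => /andP[xc xq].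
by rewrite {1}/parent_rel reparentE (eq_sym c) (negPf xc) [_ == _]cd IHq.
Qed.

(* If the closing edge has the colour of the first or of the last edge of the
   path, the triangle relation shortens the cycle; two colours span all. *)
Lemma monomial_cycle (p : seq 'I_n) (g : {ffun 'I_n -> option 'I_n}) b :
  path (parent_rel g) b p -> uniq (b :: p) -> p != [::] ->
  forall t, w t (last b p) b * mono g = 0.
Proof.
have [m] := ubnP (size p); elim: m p g b => // m IHm p g b /ltnSE.
case/lastP: p => // p a; rewrite size_rcons last_rcons => pm.
rewrite rcons_path -rcons_cons rcons_uniq => /andP[gp /eqP gv] /andP[ap up] _.
have va : last b p != a by apply: contraNneq ap => <-; apply: mem_last.
have ba : b != a by apply: contraNneq ap => <-; rewrite inE eqxx.
case: p => [|q p] in pm gp gv ap up va *.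
  (* Along a one-edge path the closing edge repeats the same pair, and products on one pair
     vanish. *)
  move=> t; apply: mul_upto_sign_eq0 (forest_monomial_edge gv) _.
  rewrite mulrA /= (tinted_sym zP _ va) mulNr -mulrA.
  by rewrite [w _ _ _ * w _ _ _](tinted_sq zP) // mulr0 oppr0 mul0r.
set v := last b (q :: p) in gv va.
have bv : b != v.
  by move: up => /= /andP[bp _]; apply: contraNneq bp => ->;
    exact: (mem_last q p).
have aq : a != q.
  by apply: contraNneq ap => ->; rewrite !inE eqxx orbT.
(* Exchange along v, a, b produces the chord from [v] to [b], which closes the path without its last
   edge. *)
have last_color : w v a b * mono g = 0.
  apply: mul_upto_sign_eq0 (forest_monomial_edge gv) _;
    rewrite mulrA (tinted_comm zP).
  rewrite tinted_exchange /= ?inE ?negb_or ?va ?(eq_sym v) ?bv 1?eq_sym ?ba //.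
  rewrite -!mulrA [w v v b * _]IHm ?mulr0 //.
  apply: path_avoid gp _.
  by move: up; rewrite lastI rcons_uniq => /andP[].
(* Exchange along a, b, q produces the chord from [a] to [q], which closes the path without its
   first edge. *)
have first_color : w b a b * mono g = 0.
  have gb : g b = Some q by move: gp => /= /andP[/eqP].
  apply: mul_upto_sign_eq0 (forest_monomial_edge gb) _; rewrite mulrA.
  rewrite tinted_exchange; last first.
    move: up; rewrite /= !inE !negb_or => /andP[/andP[bq _] _].
    by rewrite (eq_sym a) ba aq bq.
  have := IHm (rcons p a) (reparent g b None) q; rewrite last_rcons => IH.
  rewrite -mulrA IH ?mulr0 //.
  - by rewrite size_rcons.
  - apply: path_avoid; first by move: gp => /= /andP[_ qp];
      rewrite rcons_path qp /=; apply/eqP.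
    by rewrite belast_rcons; move: up => /= /andP[].
  - by rewrite -rcons_cons rcons_uniq; move: ap up;
      rewrite inE negb_or => /andP[_ ->] /= /andP[].
  - by case: (p).
move=> t; have [|al [be ->]] := @tinted_interp t v b.
  by rewrite -val_eqE eq_sym in bv.
by rewrite mulrDl -!scalerAl last_color first_color !scaler0 addr0.
Qed.

Definition forest_spanned (r : R) : Prop :=
  exists c : {ffun 'I_n -> option 'I_n} -> rat,
    r = \sum_(f | forest f) c f *: mono f.

Lemma spanned0 : forest_spanned 0.
Proof. by exists (fun=> 0); rewrite big1 // => f _; rewrite scale0r. Qed.

Lemma spannedD r s : forest_spanned r -> forest_spanned s ->
  forest_spanned (r + s).
Proof.
case=> c -> [d ->]; exists (fun f => c f + d f); rewrite -big_split /=.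
by apply: eq_bigr => f _; rewrite scalerDl.
Qed.

Lemma spannedZ a r : forest_spanned r -> forest_spanned (a *: r).
Proof.
case=> c ->; exists (fun f => a * c f); rewrite scaler_sumr.
by apply: eq_bigr => f _; rewrite scalerA.
Qed.

Lemma spannedN r : forest_spanned r -> forest_spanned (- r).
Proof. by rewrite -scaleN1r; apply: spannedZ. Qed.

Lemma spanned_sign (s : bool) r : forest_spanned r ->
  forest_spanned ((-1) ^+ s * r).
Proof.
case: s => rV; rewrite ?expr1 ?expr0 ?mul1r // mulN1r.
exact: spannedN.
Qed.

Lemma spanned_mono f : forest f -> forest_spanned (mono f).
Proof.
move=> ff; exists (fun g => (g == f)%:R); rewrite (bigD1 f) //= eqxx scale1r.
by rewrite big1 ?addr0 // => g /andP[_ /negPf->]; rewrite scale0r.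
Qed.

Lemma sign_mul_eq s (u v : R) : u = (-1) ^+ s * v -> v = (-1) ^+ s * u.
Proof. by move=> ->; rewrite mulrA -expr2 sqrr_sign mul1r. Qed.

(** If [b] lies below [a], the new edge closes a cycle and the product vanishes. Otherwise grafting
    changes ranks only in the subtree of [a], which contains neither [b] nor any vertex ranked lower
    than [a]. *)
Lemma graft_monomial g h (a b : 'I_n) : g a = None -> ranked g h -> a != b ->
  w a a b * mono g = 0 \/
  exists h', [/\ ranked (reparent g a (Some b)) h',
    forall v : 'I_n, (h v < h a)%N -> h' v = h v, h' b = h b &
    eq_upto_sign (w a a b * mono g) (mono (reparent g a (Some b)))].
Proof.
move=> ga gh ab; have [/connectP[p0 gp0 a0]|ba] := boolP (descends g b a).
  left; case/shortenP: gp0 a0 => p gp up _ aE.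
  rewrite {2}aE; apply: monomial_cycle => //.
  by apply: contraNneq ab => p0'; rewrite aE p0'.
have [h' gh' h'E] := ranked_reparent ga gh ba.
right; exists h'; split=> //; last first.
- have [s /sign_mul_eq sE] := forest_monomial_reparent zP g a b.
  by exists s; rewrite -{1}(reparent_id g a) ga.
- exact: h'E.
by move=> v va; apply: h'E; apply: contraTN va => /(ranked_descends gh);
  rewrite -leqNgt.
Qed.

(* If a has parent k, [tinted_fork] replaces the extra edge ab by kb, both in f
   and in f with a moved below b; the ranks of k and b are the same in both. *)
Lemma straighten N f h (a b : 'I_n) t : ranked f h -> a != b ->
  (h a + h b < N)%N -> forest_spanned (w t a b * mono f).
Proof.
elim: N f h a b t => // N IHN f h a b t fh ab /ltnSE hN.
(* The colours [a] and [b] span the pencil, and turning the edge around exchanges its ends, so an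
   edge may be assumed to carry the colour of its first end. *)
suff step (c d : 'I_n) : c != d -> (h c + h d <= N)%N ->
  forest_spanned (w c c d * mono f).
  have [|al [be ->]] := @tinted_interp t a b; first by rewrite val_eqE.
  rewrite mulrDl -!scalerAl; apply: spannedD; apply: spannedZ;
    first exact: step.
  rewrite (tinted_sym zP) 1?eq_sym // mulNr -mulrA.
  by apply/spannedN/spanned_sign/step; rewrite 1?eq_sym // addnC.
move=> {a b t ab hN} cd hN; case fc: (f c) => [k|]; last first.
  have [->|[h' [fh' _ _ [s ->]]]] := graft_monomial fc fh cd;
    first exact: spanned0.
  by apply/spanned_sign/spanned_mono/asboolP; exists h'.
have [s fE] := forest_monomial_edge fc.
have ck : c != k by apply: contraTneq (fh _ _ fc) => ->; rewrite ltnn.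
have [kd|kd] := eqVneq k d.
  rewrite (mul_upto_sign_eq0 (forest_monomial_edge fc)); first exact: spanned0.
  by rewrite mulrA -kd (tinted_sq zP) // mul0r.
(* The parent [k] ranks below [c], so the edge dk has a smaller rank sum than cd. *)
have hk : (h d + h k < N)%N by apply: leq_trans hN; rewrite addnC ltn_add2r fh.
have dk : d != k by rewrite eq_sym.
set g := reparent f c None in fE.
have gh : ranked g h by apply: ranked_reparent_None.
have gc : g c = None by rewrite reparentE eqxx.
have -> : w c c d * mono f = (-1) ^+ s * ((-1) ^+ par *
    (w c d k * (w c c d * mono g) - (-1) ^+ s * (w c d k * mono f))).
  rewrite {1}fE [LHS]mulrA commr_sign -[LHS]mulrA; congr (_ * _).
  rewrite [LHS]mulrA tinted_fork /= ?inE ?negb_or ?cd ?ck ?dk // -mulrA;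
    congr (_ * _).
  rewrite -mulrA mulrBl mulrBr; congr (_ - _).
  by rewrite {1}(sign_mul_eq fE) mulrA commr_sign -mulrA.
apply/spanned_sign/spanned_sign/spannedD; last first.
  by apply/spannedN/spanned_sign; apply: IHN fh dk hk.
have [->|[h' [gh' h'E h'd [s' ->]]]] := graft_monomial gc gh cd.
  by rewrite mulr0; apply: spanned0.
rewrite mulrA commr_sign -mulrA; apply: spanned_sign; apply: IHN gh' dk _.
by rewrite h'd h'E ?fh.
Qed.

(** Straightening applies to both generators because x = w_0 and y = w_1 - w_0. *)
Lemma spanned_gen c (a b : 'I_n) r : a != b -> forest_spanned r ->
  forest_spanned (z c a b * r).
Proof.
move=> ab [d ->]; rewrite mulr_sumr; elim/big_ind: _ => [||f /asboolP[h fh]].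
- exact: spanned0.
- exact: spannedD.
rewrite -scalerAr; apply: spannedZ.
have S t : forest_spanned (w t a b * mono f).
  exact: straighten fh ab (ltnSn _).
have S0 : forest_spanned (z false a b * mono f).
  by have := S 0%N; rewrite /tinted mulr0n addr0.
case: c => //; have -> : z true a b = w 1%N a b + - 1 *: z false a b.
  by rewrite /tinted mulr1n scaleN1r addrAC subrr add0r.
by rewrite mulrDl -scalerAl; apply/spannedD/spannedZ.
Qed.

End Spanning.
End Configurations.

(** * Contraction of an edge and independence *)

Lemma mx_scaleAl p x (a b : 'M[rat]_p) : (x *: a) * b = x *: (a * b).
Proof. by rewrite -[LHS]/(_ *m _) -scalemxAl. Qed.

Lemma mx_scaleAr p x (a b : 'M[rat]_p) : a * (x *: b) = x *: (a * b).
Proof. by rewrite -[LHS]/(_ *m _) -scalemxAr. Qed.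

Section Contraction.
Variables (n : nat) (par : bool) (m : nat).
Variables (i j : 'I_n) (z : bool -> 'I_n -> 'I_n -> 'M[rat]_m).
Hypotheses (ij : i != j) (zP : os_family par z).
Local Notation sg := ((-1) ^+ par : rat).
Implicit Types (f g h : {ffun 'I_n -> option 'I_n}) (k l p q u v : 'I_n).

Definition twisted_diag (a : 'M[rat]_m) : 'M[rat]_(m + m) :=
  block_mx a 0 0 (sg *: a).
Local Notation D := twisted_diag.
Definition shift_mx : 'M[rat]_(m + m) := block_mx 0 1 0 0.
Local Notation S := shift_mx.

(** The functional sending x to -j and y to 1, hence w_t to t - j: it vanishes exactly at colour
    [j]. *)
Definition merge_weight (c : bool) : rat := if c then 1 else - j%:R.

Definition merge_vertex k := if k == i then j else k.

(* The pair {i, j} acts by a square-zero shift, weighted so that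
   [tinted contracted j j i = 0]; the sign in [twisted_diag] makes the other
   generators commute or anticommute with the shift. *)
Definition contracted (c : bool) (k l : 'I_n) : 'M[rat]_(m + m) :=
  if (k == i) && (l == j) then merge_weight c *: S
  else if (k == j) && (l == i) then - (sg * merge_weight c) *: S
  else D (z c (merge_vertex k) (merge_vertex l)).

Lemma sg_scale (d : nat) (a : 'M[rat]_d) : (-1) ^+ par * a = sg *: a.
Proof.
by case: par; rewrite ?expr1 ?expr0 ?mul1r ?scale1r // mulN1r scaleN1r.
Qed.

Lemma sg_sg : sg * sg = 1.
Proof. by rewrite -expr2 sqrr_sign. Qed.

Lemma twisted_diagM a b : D a * D b = block_mx (a * b) 0 0 (a * b).
Proof.
rewrite -[LHS]/(_ *m _) mulmx_block !mul0mx !mulmx0 !addr0 !add0r.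
by rewrite -scalemxAl -scalemxAr scalerA sg_sg scale1r.
Qed.

Lemma shift_sq : S * S = 0.
Proof.
rewrite -[LHS]/(_ *m _) mulmx_block !mul0mx !mulmx0 !addr0.
by rewrite block_mx0.
Qed.

Lemma twisted_diag_shift a : D a * S = sg *: (S * D a).
Proof.
rewrite -[LHS]/(_ *m _) -[S * _]/(_ *m _) !mulmx_block !mul0mx !mulmx0 !addr0
  !add0r.
by rewrite mulmx1 mul1mx scale_block_mx !scaler0 scalerA sg_sg scale1r.
Qed.

Lemma twisted_diagZ x a : D (x *: a) = x *: D a.
Proof. by rewrite /D scale_block_mx !scaler0 !scalerA mulrC. Qed.

Definition merged_pair k l := (k == i) && (l == j) || (k == j) && (l == i).

Lemma merged_pairC k l : merged_pair k l = merged_pair l k.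
Proof.
by rewrite /merged_pair orbC [(k == j) && _]andbC [(k == i) && _]andbC.
Qed.

Lemma contracted_merged k l : merged_pair k l ->
  exists mu, forall c, contracted c k l = (mu * merge_weight c) *: S.
Proof.
rewrite /merged_pair /contracted; case: (_ && _) => /= [_|->].
  by exists 1 => c; rewrite mul1r.
by exists (- sg) => c; rewrite mulNr.
Qed.

Lemma contracted_unmerged c k l : ~~ merged_pair k l ->
  contracted c k l = D (z c (merge_vertex k) (merge_vertex l)).
Proof. by rewrite negb_or /contracted => /andP[/negPf-> /negPf->]. Qed.

Lemma merge_neq k l : k != l -> ~~ merged_pair k l ->
  merge_vertex k != merge_vertex l.
Proof.
rewrite /merged_pair /merge_vertex.
have [->|ki] := eqVneq k i; have [->|li] := eqVneq l i;
  rewrite ?eqxx //= ?andbF ?orbF //.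
  by rewrite eq_sym.
by rewrite andbT.
Qed.

Lemma contracted_sym c k l : k != l ->
  contracted c l k = - ((-1) ^+ par * contracted c k l).
Proof.
move=> kl; rewrite sg_scale; have [kl2|kl2] := boolP (merged_pair k l);
  last first.
  rewrite !contracted_unmerged // 1?merged_pairC //.
  by rewrite (os_sym zP _ (merge_neq kl kl2)) sg_scale -scaleNr twisted_diagZ
    scaleNr.
rewrite /contracted; case/orP: kl2 => /andP[/eqP-> /eqP->].
  rewrite !eqxx /= [j == i]eq_sym (negPf ij) /=.
  by rewrite scalerA scaleNr.
rewrite !eqxx /= [j == i]eq_sym (negPf ij) /=.
by rewrite scalerA mulrN scaleNr opprK mulrA sg_sg mul1r.
Qed.

Lemma contracted_comm c d k l p q :
  contracted c k l * contracted d p q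
    = (-1) ^+ par * (contracted d p q * contracted c k l).
Proof.
rewrite sg_scale; have [kl|kl] := boolP (merged_pair k l);
  have [pq|pq] := boolP (merged_pair p q).
- have [mu ->] := contracted_merged kl; have [nu ->] := contracted_merged pq.
  by rewrite !mx_scaleAl !mx_scaleAr shift_sq !scaler0.
- have [mu ->] := contracted_merged kl; rewrite contracted_unmerged //.
  rewrite [in LHS]mx_scaleAl [in RHS]mx_scaleAr twisted_diag_shift !scalerA.
  by rewrite mulrAC sg_sg mul1r.
- have [mu ->] := contracted_merged pq; rewrite contracted_unmerged //.
  by rewrite [in LHS]mx_scaleAr [in RHS]mx_scaleAl twisted_diag_shift !scalerA
    mulrC.
rewrite !contracted_unmerged // !twisted_diagM (os_comm zP) sg_scale.
by rewrite scale_block_mx !scaler0.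
Qed.

Lemma contracted_sq c d k l : k != l -> contracted c k l * contracted d k l = 0.
Proof.
move=> kl; have [klp|klp] := boolP (merged_pair k l).
  by have [mu muE] := contracted_merged klp;
    rewrite !muE !mx_scaleAl !mx_scaleAr shift_sq !scaler0.
rewrite !contracted_unmerged // twisted_diagM (os_sq zP) ?block_mx0 //.
exact: merge_neq.
Qed.

(** After merging, lp and pk are the same pair, so their product vanishes; the two products with the
    shift cancel against those with [c] and [d] exchanged. *)
Lemma contracted_triangle_merged c d k l p : uniq [:: k; l;
  p] -> merged_pair k l ->
  triangle contracted c d k l p + triangle contracted d c k l p = 0.
Proof.
move=> u kl; have [[kp lp] [kl0 klj]] : (k != p /\ l != p) /\ (merge_vertex k =
  j /\ merge_vertex l = j).
  move: u kl; rewrite /= !inE negb_or -!andbA andbT => /and3P[_ -> ->].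
  by rewrite /merged_pair /merge_vertex => /orP[] /andP[/eqP-> /eqP->];
    rewrite eqxx; case: eqP.
have pE : merge_vertex p = p.
  rewrite /merge_vertex; case: eqP => // pi; move: kl kp lp; rewrite pi.
  by case/orP=> /andP[/eqP-> /eqP->]; rewrite eqxx.
have jp : j != p.
  by move: kl kp lp; case/orP=> /andP[/eqP-> /eqP->].
have lpu : ~~ merged_pair l p.
  by apply/negP => /orP[] /andP[_ /eqP pE']; move: kl kp lp; rewrite pE';
    case/orP=> /andP[/eqP-> /eqP->]; rewrite ?eqxx.
have pku : ~~ merged_pair p k.
  by apply/negP => /orP[] /andP[/eqP pE' _]; move: kl kp lp; rewrite pE';
    case/orP=> /andP[/eqP-> /eqP->]; rewrite ?eqxx.
have [mu muE] := contracted_merged kl.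
rewrite /triangle !(contracted_unmerged _ lpu) !(contracted_unmerged _ pku)
  !muE.
rewrite kl0 klj pE !(os_sym zP _ jp) !sg_scale -!scaleNr !twisted_diagZ.
rewrite !mx_scaleAl !mx_scaleAr !twisted_diagM !(os_sq zP) // !block_mx0
  !scaler0.
rewrite !twisted_diag_shift !scalerA.
have sE x : - sg * x * sg = - x by rewrite mulrAC mulNr sg_sg mulN1r.
by rewrite !sE !addr0 !scaleNr addrA subrK subrr.
Qed.

Lemma contracted_family : os_family par contracted.
Proof.
split; [exact: contracted_sym|exact: contracted_comm| |exact: contracted_sq].
move=> c d k l p u.
(* Rotating the triangle brings a merged side to the front. *)
have rot c' d' k' l' p' : triangle contracted c' d' k' l' p' = triangle
  contracted c' d' l' p' k'.
  by rewrite /triangle -addrA addrC.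
have [kl|kl] := boolP (merged_pair k l); first exact:
  contracted_triangle_merged.
have [lp|lp] := boolP (merged_pair l p).
  by rewrite rot [X in _ + X]rot; apply: contracted_triangle_merged lp;
    rewrite -(rot_uniq 1) in u.
have [pk|pk] := boolP (merged_pair p k).
  by rewrite -rot -[X in _ + X]rot; apply: contracted_triangle_merged pk;
    rewrite -(rot_uniq 2) in u.
(* With no merged side, [i] and [j] are not both among the vertices, so merging keeps the three
   distinct. *)
have um : uniq [:: merge_vertex k; merge_vertex l; merge_vertex p].
  move: u; rewrite /= !inE !negb_or !andbT => /andP[/andP[kl' kp'] lp'].
  rewrite !merge_neq // 1?merged_pairC //.
have := os_triangle zP c d um.
rewrite /triangle !contracted_unmerged // !twisted_diagM => T0.
by rewrite !add_block_mx T0 !addr0 block_mx0.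
Qed.

(** The vertex [i] stays in the vertex set as an isolated root, so contraction does not change the
    index type. *)
Definition contract (f : {ffun 'I_n -> option 'I_n}) : {ffun 'I_n ->
  option 'I_n} :=
  [ffun v => if v == i then None else omap merge_vertex (f v)].

(** The factor between the two diagonal blocks of the product over [r]: one sign per edge. *)
Definition contract_sign (r : seq 'I_n) (h : {ffun 'I_n ->
  option 'I_n}) : rat :=
  \prod_(v <- r) (if h v then sg else 1).

Lemma tinted_contracted t k l : ~~ merged_pair k l ->
  tinted contracted t k l = D (tinted z t (merge_vertex k) (merge_vertex l)).
Proof.
move=> kl; rewrite /tinted !contracted_unmerged // -scaler_nat -twisted_diagZ.
by rewrite /D add_block_mx !addr0 -scalerDr scaler_nat.
Qed.

Lemma tinted_contracted_ij t : tinted contracted t i j = (t%:R - j%:R) *: S.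
Proof.
by rewrite /tinted /contracted !eqxx /= -scaler_nat scalerA mulr1 -scalerDl
  addrC.
Qed.

Lemma tinted_contracted_ji : tinted contracted j j i = 0.
Proof.
rewrite /tinted /contracted !eqxx [j == i]eq_sym (negPf ij) /= -scaler_nat
  scalerA -scalerDl.
by rewrite mulr1 mulrN opprK mulrN [_ * sg]mulrC subrr scale0r.
Qed.

Notation edge_factor zz f v :=
  (if f v is Some u then tinted zz (nat_of_ord v) v u else 1).

Lemma edge_factor_contracted f v : v != i -> (v, f v) != (j, Some i) ->
  edge_factor contracted f v = block_mx (edge_factor z (contract f) v) 0 0
   ((if contract f v then sg else 1) *: edge_factor z (contract f) v).
Proof.
move=> vi; rewrite ffunE (negPf vi); case: (f v) => [u|] vf /=.
  rewrite tinted_contracted; first by rewrite {1}/merge_vertex (negPf vi).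
  rewrite /merged_pair (negPf vi) /=.
  by apply: contra vf => /andP[/eqP-> /eqP->].
by rewrite scale1r -scalar_mx_block.
Qed.

Lemma prod_contracted f r : i \notin r -> f j != Some i ->
  \prod_(v <- r) edge_factor contracted f v =
    block_mx (\prod_(v <- r) edge_factor z (contract f) v) 0 0
      (contract_sign r (contract f) *: \prod_(v <- r) edge_factor z (contract
        f) v).
Proof.
move=> + fj; rewrite /contract_sign; elim: r => [|v r IHr].
  by rewrite !big_nil scale1r -scalar_mx_block.
rewrite inE negb_or !big_cons => /andP[vi /IHr->].
rewrite edge_factor_contracted 1?eq_sym //; last first.
  by apply: contra fj => /eqP[<- ->].
rewrite -[LHS]/(_ *m _) mulmx_block !mul0mx !mulmx0 !addr0 !add0r.
by rewrite -scalemxAl -scalemxAr scalerA.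
Qed.

(** Every factor is block diagonal: only the pair {i, j} could contribute a shift, and the edge from
    [j] to [i] has weight 0. *)
Lemma ursubmx_monomial_neq f : f i != Some j ->
  ursubmx (forest_monomial contracted f) = 0.
Proof.
move=> fi; suff [a [b ->]] : exists a b, forest_monomial contracted f =
  block_mx a 0 0 b.
  by rewrite block_mxKur.
rewrite /forest_monomial; elim/big_ind: _ => [|_ _ [a [b ->]] [a' [b' ->]]|v _].
- by exists 1, 1; rewrite -scalar_mx_block.
- exists (a * a'), (b * b'); rewrite -[LHS]/(_ *m _).
  by rewrite mulmx_block !mul0mx !mulmx0 !addr0 !add0r.
case fv: (f v) => [u|]; last by exists 1, 1; rewrite -scalar_mx_block.
have [/orP[]/andP[/eqP vE /eqP uE]|vu] := boolP (merged_pair v u).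
- by rewrite vE uE in fv; rewrite fv eqxx in fi.
- by exists 0, 0; rewrite vE uE tinted_contracted_ji block_mx0.
by rewrite tinted_contracted //; eexists; eexists.
Qed.

(** The weight of the edge from [i] to [j], times the signs of the factors that follow [i] in the
    product. *)
Definition contract_coef (h : {ffun 'I_n -> option 'I_n}) : rat :=
  let r := index_enum 'I_n in
  (i%:R - j%:R) * contract_sign (drop (index i r).+1 r) h.

Lemma contract_coef_neq0 h : contract_coef h != 0.
Proof.
rewrite mulf_neq0 ?subr_eq0 ?eqr_nat // /contract_sign prodf_seq_neq0.
by apply/allP=> v _; case: (h v) => [u|]; rewrite ?oner_eq0 ?signr_eq0.
Qed.

Lemma ursubmx_monomial f : f i = Some j -> f j != Some i ->
  ursubmx (forest_monomial contracted f)
    = contract_coef (contract f) *: forest_monomial z (contract f).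
Proof.
move=> fi fj; rewrite /forest_monomial /contract_coef.
move: (index_enum_uniq 'I_n) (mem_index_enum i).
move: (index_enum _) => r /[swap]; case/path.splitP => r1 r2.
rewrite cat_uniq rcons_uniq -!andbA => /and4P[ir1 _ ir2 _].
rewrite !big_cat !big_rcons /= !prod_contracted //; last first.
  by apply: contra ir2 => ir2; apply/hasP; exists i;
    rewrite // mem_rcons inE eqxx.
rewrite fi tinted_contracted_ij [contract f i]ffunE eqxx mulr1.
rewrite mx_scaleAr mx_scaleAl -[_ * S * _]/(_ *m _ *m _) /S.
rewrite !mulmx_block !mul0mx !mulmx0 !addr0 !add0r scale_block_mx block_mxKur.
by rewrite mulmx1 -scalemxAr scalerA.
Qed.

End Contraction.

(** * Linear independence of the forest monomials *)

Section Independence.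
Variables (n : nat) (par : bool).
Implicit Types (f g h : {ffun 'I_n -> option 'I_n}) (i j k l p q u v : 'I_n).

Lemma ranked_contract i j f (d : 'I_n -> nat) :
  f i = Some j -> ranked f d -> ranked (contract i j f) d.
Proof.
move=> fi fh v u; rewrite ffunE; case: eqP => // _;
  case fv: (f v) => [w|] //= [<-].
rewrite /merge_vertex; case: eqP => [wi|_]; last exact: fh.
by rewrite (ltn_trans (fh _ _ fi)) // -wi; apply: fh.
Qed.

Lemma forest_contract i j f : f i = Some j -> forest f ->
  forest (contract i j f).
Proof.
by move=> fi /asboolP[h fh]; apply/asboolP; exists h; apply: ranked_contract.
Qed.

Lemma num_edges_contract i j f : f i = Some j ->
  num_edges f = (num_edges (contract i j f)).+1.
Proof.
move=> fi; rewrite (num_edges_reparent_None fi); congr _.+1.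
by apply: eq_card => v; rewrite !inE !ffunE; case: eqP => // _; case: (f v).
Qed.

Definition parents f := [set u | [exists v, f v == Some u]].

(** Since [i] is a leaf of [f], a different [g] with the same contraction must attach some vertex to
    [i]. Its parents then include [i] and still all parents of [f], because [j] is the parent of [i]
    in both. *)
Lemma parents_contract i j f g : i != j -> f i = Some j -> leaf f i ->
  g i = Some j -> contract i j g = contract i j f -> g != f ->
  (#|parents f| < #|parents g|)%N.
Proof.
move=> ij fi /forallP fl gi gf neq.
have fE v : v != i -> contract i j f v = f v.
  move=> vi; rewrite ffunE (negPf vi); have := fl v; case: (f v) => //= u ui.
  by rewrite /merge_vertex; have [ui'|//] := eqVneq u i; rewrite ui' eqxx in ui.
have gE v : v != i -> f v = omap (merge_vertex i j) (g v).
  by move=> vi; rewrite -fE // -gf ffunE (negPf vi).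
have [v gv] : exists v, g v = Some i.
  have [v fgv] : exists v, g v != f v.
    by apply/existsP; apply: contraNT neq => /existsPn H; apply/eqP/ffunP=> v;
      apply/eqP/negPn.
  exists v; have vi : v != i by apply: contraNneq fgv => ->; rewrite fi gi.
  move: fgv; rewrite gE //; case: (g v) => [u|] //=; rewrite /merge_vertex.
  by have [->|] := eqVneq u i; rewrite ?eqxx.
apply: proper_card; apply/properP; split.
  apply/subsetP=> u; rewrite !inE => /existsP[x /eqP fx]; apply/existsP.
  have [xi|xi] := eqVneq x i; first by exists i; rewrite gi -fi -xi fx.
  move: fx; rewrite gE //; case gx: (g x) => [t|] //= [].
  rewrite /merge_vertex; case: eqP => [_ <-|_ <-]; last by exists x; rewrite gx.
  by exists i; rewrite gi.
exists i; rewrite !inE; first by apply/existsP; exists v; rewrite gv.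
by apply/existsPn.
Qed.

(** All matrix sizes are needed at once: a relation in size [m] is derived from contracted families
    of size [m + m]. *)
Definition vanishing (c : {ffun 'I_n -> option 'I_n} -> rat) :=
  forall m (z : bool -> 'I_n -> 'I_n -> 'M[rat]_m), os_family par z ->
    \sum_(f | forest f) c f *: forest_monomial z f = 0.

Lemma vanishing_coef0 (c : {ffun 'I_n -> option 'I_n} -> rat) : vanishing c ->
  (forall f, forest f -> (0 < num_edges f)%N -> c f = 0) -> c [ffun=> None] = 0.
Proof.
move=> cv c0.
have zP : os_family par (fun (_ : bool) (_ _ : 'I_n) => 0 : 'M[rat]_1).
  by split=> *; rewrite /triangle ?(mulr0, oppr0, addr0).
have := cv _ _ zP; rewrite (bigD1 [ffun=> None]) ?forest0 //= big1 ?addr0;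
  last first.
  move=> f /andP[ff]; rewrite -num_edges_eq0 -lt0n => f0.
  by rewrite c0 ?scale0r.
rewrite /forest_monomial big1 => [|v _]; last by rewrite ffunE.
move=> /eqP; rewrite scaler_eq0 oner_eq0 orbF => /eqP; exact.
Qed.

(** The upper right block of the relation for the contracted family, with the surviving forests
    grouped by their contraction. *)
Lemma vanishing_contract i j c : i != j -> vanishing c ->
  vanishing (fun h => contract_coef par i j h *
     \sum_(f | forest f && (f i == Some j) && (contract i j f == h)) c f).
Proof.
move=> ij cv m z zP; have := cv _ _ (contracted_family ij zP).
move=> /(congr1 (mxsub (lshift m) (@rshift m m)));
  rewrite linear0 linear_sum /=.
rewrite (bigID (fun f => f i == Some j)) /= [X in _ + X]big1 ?addr0; last first.
  by move=> f /andP[_ fi]; rewrite linearZ /= -ursubmxEsub ursubmx_monomial_neq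
    ?scaler0.
rewrite (partition_big (contract i j) (@forest _)) /=; last first.
  by move=> f /andP[ff /eqP fi]; apply: forest_contract.
move=> cz; rewrite -[RHS]cz; apply: eq_bigr => h hf.
rewrite mulr_sumr scaler_suml; apply: eq_bigr =>
  f /andP[/andP[ff /eqP fi] /eqP <-].
rewrite linearZ /= -ursubmxEsub ursubmx_monomial // ?scalerA 1?mulrC //.
apply/eqP=> fj; case/asboolP: ff => r fr.
by have := fr _ _ fi; rewrite ltnNge ltnW // fr.
Qed.

(** The outer induction bounds the number of edges, which contraction lowers. The inner one runs
    downwards on the number of parents: contracting a leaf edge of [f] leaves [c f] plus
    coefficients of forests with more parents, already known to be 0. *)
Lemma vanishing_eq0 c : vanishing c -> forall f, forest f -> c f = 0.
Proof.
suff main d : forall c, vanishing c ->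
    (forall f, forest f -> (d < num_edges f)%N -> c f = 0) ->
    forall f, forest f -> c f = 0.
  move=> cv; apply: (main #|'I_n| c cv) => f ff.
  by rewrite ltnNge max_card.
move=> {c}; elim: d => [|d IHd] c cv cd.
  move=> f ff; have [f0|/cd->//] := posnP (num_edges f).
  move/eqP: f0; rewrite num_edges_eq0 => /eqP->.
  exact: vanishing_coef0.
suff pos f : forest f -> (0 < num_edges f)%N -> c f = 0.
  move=> f ff; have [f0|/pos->//] := posnP (num_edges f).
  by move/eqP: f0; rewrite num_edges_eq0 => /eqP->; apply: vanishing_coef0.
have [m] := ubnP (#|'I_n| - #|parents f|)%N;
  elim: m f => // m IHm f /ltnSE fm ff f0.
have [i [j [fi fl]]] := forest_leaf ff f0.
have ij : i != j := forest_neq ff fi.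
have h0 : contract_coef par i j (contract i j f) *
   \sum_(g | forest g && (g i == Some j) &&
     (contract i j g == contract i j f)) c g = 0.
  apply: (IHd _ (vanishing_contract ij cv)); last exact: forest_contract.
  move=> h hf hd; rewrite big1 ?mulr0 // => g /andP[/andP[gf /eqP gi] /eqP gh].
  by apply: cd; rewrite // (num_edges_contract gi) gh.
move/eqP: h0; rewrite mulf_eq0 (negPf (contract_coef_neq0 _ ij _)) /= =>
  /eqP h0.
rewrite -[RHS]h0 (bigD1 f) /=; last by rewrite ff fi !eqxx.
rewrite big1 ?addr0 // => g /andP[/andP[/andP[gf /eqP gi] /eqP gc] gneq].
have lt_parents := parents_contract ij fi fl gi gc gneq.
apply: IHm gf _; last by rewrite (num_edges_contract gi).
by apply: leq_trans fm; rewrite ltn_sub2l // (leq_trans lt_parents) ?max_card.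
Qed.

End Independence.

(** * The quotient algebras *)

Lemma has_dim_basis (K : fieldType) (V : lmodType K) (I : finType) (P : pred I)
    (b : I -> V) :
  (forall v, exists c : I -> K, v = \sum_(i | P i) c i *: b i) ->
  (forall c : I -> K, \sum_(i | P i) c i *: b i = 0 ->
    forall i, P i -> c i = 0) ->
  has_dim V #|P|.
Proof.
move=> span free; pose comb (u : 'rV[K]_#|P|) := \sum_k u 0 k *: b (enum_val k).
have combE c : comb (\row_k c (enum_val k)) = \sum_(i | P i) c i *: b i.
  by rewrite [RHS]big_enum_val; apply: eq_bigr => k _; rewrite mxE.
have combB u v : comb (u - v) = comb u - comb v.
  by rewrite -sumrB; apply: eq_bigr => k _; rewrite !mxE scalerBl.
have comb_inj : injective comb.
  move=> u v /eqP; rewrite -subr_eq0 -combB => /eqP uv0.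
  apply/eqP; rewrite -subr_eq0; apply/eqP/rowP => k; set d := u - v in uv0 *.
  have i0 := enum_valP k.
  pose c i := if (insub (enum_rank_in i0 i : nat) : option 'I_#|P|) is Some l
    then d 0 l else 0.
  have cE l : c (enum_val l) = d 0 l.
    by rewrite /c enum_valK_in valK.
  rewrite [RHS]mxE -cE; apply: free => //; rewrite -combE -[RHS]uv0;
    congr (comb _).
  by apply/rowP=> l; rewrite mxE cE.
have combP v : exists u, comb u = v.
  by have [c ->] := span v; exists (\row_k c (enum_val k)).
pose coords v := sval (cid (combP v)).
have coordsK : cancel coords comb by move=> v; apply: (svalP (cid (combP v))).
have combK : cancel comb coords by move=> u; apply: comb_inj; rewrite coordsK.
constructor; exists coords; last by exists comb.
move=> a u v; apply: comb_inj; rewrite coordsK -{1}(coordsK u) -{1}(coordsK v).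
rewrite /comb scaler_sumr -big_split; apply: eq_bigr => k _ /=.
by rewrite !mxE scalerDl scalerA.
Qed.

(** * Evaluation of the free algebra and the sign rule *)

Section Evaluation.
Variables (X : choiceType) (B : algType rat) (G : X -> B).

Definition eval_word (u : {fmonom X}) : B := \prod_(g <- u) G g.

Fact eval_word_mmorphism : mmorphism eval_word.
Proof.
split=> [u v|]; last by rewrite /eval_word fm1 big_nil.
by rewrite /eval_word fmM big_cat.
Qed.

HB.instance Definition _ :=
  isMultiplicative.Build {fmonom X} B eval_word eval_word_mmorphism.

(* Locked: unfolding [mmap] makes unification of the ring structures slow. *)
Definition eval_free : freealg rat X -> B :=
  locked (mmap (in_alg B) eval_word).

Lemma eval_freeD : {morph eval_free : f g / f + g}.
Proof. by rewrite /eval_free -lock; apply: mmapD. Qed.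

Lemma eval_freeM : {morph eval_free : f g / f * g}.
Proof.
have H : multiplicative (mmap (in_alg B) eval_word).
  apply: commr_mmap_is_multiplicative => g m m'.
  by rewrite /GRing.comm /= mulr_algl mulr_algr.
by rewrite /eval_free -lock; apply: H.1.
Qed.

Lemma eval_fgen g : eval_free (fgen rat g) = G g.
Proof.
by rewrite /eval_free -lock mmapU /= scale1r mul1r /eval_word fmU big_seq1.
Qed.

Local Notation ev := eval_free.

Lemma eval_free0 : ev 0 = 0.
Proof. by rewrite /eval_free -lock; apply: mmap0. Qed.

Lemma eval_freeN : {morph ev : f / - f}.
Proof. by rewrite /eval_free -lock; apply: mmapN. Qed.

Lemma eval_free1 : ev 1 = 1.
Proof. by rewrite /eval_free -lock; apply: mmap1. Qed.

Lemma eval_freeZ a f : ev (a *: f) = a *: ev f.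
Proof. by rewrite /eval_free -lock mmapZ /= mulr_algl. Qed.

Variable par : bool.
Hypothesis GC : forall g h, G g * G h = (-1) ^+ par * (G h * G g).

Lemma eval_word_comm (u v : seq X) :
  (\prod_(g <- u) G g) * (\prod_(g <- v) G g) =
  (-1) ^+ (par && odd (size u) && odd (size v))
    * ((\prod_(g <- v) G g) * (\prod_(g <- u) G g)).
Proof.
have letter g : G g * (\prod_(h <- v) G h)
    = (-1) ^+ (par && odd (size v)) * ((\prod_(h <- v) G h) * G g).
  elim: v => [|h v IHv]; first by rewrite andbF !big_nil !mul1r mulr1.
  rewrite !big_cons mulrA GC -!mulrA IHv [G h * ((-1) ^+ _ * _)]mulrA
    commr_sign -!mulrA.
  by rewrite [LHS]mulrA -signr_addb /=; case: par; case: (odd _).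
elim: u => [|g u IHu]; first by rewrite andbF !big_nil !mul1r mulr1.
rewrite !big_cons -mulrA IHu [LHS]mulrA commr_sign -mulrA [G g * (_ * _)]mulrA
  letter.
rewrite -!mulrA [LHS]mulrA -signr_addb.
by congr (_ ^+ _ * _) => /=; case: par; case: (odd _) => //=; case: (odd _).
Qed.

(** Expanding into words reduces this to [eval_word_comm]; a word has the parity of its length when
    generators are odd, and is even otherwise. *)
Lemma eval_free_comm p q a b :
  homogeneous (fun=> par) p a -> homogeneous (fun=> par) q b ->
  ev a * ev b = (-1) ^+ (p && q) * (ev b * ev a).
Proof.
move=> ap bq; rewrite /eval_free -lock /mmap.
rewrite mulr_suml mulr_suml mulr_sumr.
under eq_bigr do rewrite mulr_sumr; rewrite exchange_big /=.
rewrite big_seq [RHS]big_seq; apply: eq_bigr => v /bq vq.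
rewrite mulr_sumr mulr_sumr big_seq [RHS]big_seq; apply: eq_bigr => u /ap up.
rewrite !mulr_algl -!scalerAl -!scalerAr eval_word_comm.
rewrite [RHS]scalerA [b@_v * _]mulrC -[RHS]scalerA.
suff -> : par && odd (size u) && odd (size v) = p && q by [].
move: up vq; rewrite /word_parity; case: par.
  by rewrite !(@eq_count _ _ predT) // !count_predT => -> ->.
by rewrite !(@eq_count _ _ pred0) // !count_pred0 => <- <-.
Qed.

End Evaluation.

(** * Transfer to the presented algebras *)

Section DoubleOrlikSolomon.
Variables (n : nat) (par : bool).
Local Notation F := (freealg rat (OSgen n)).

Definition OSxy (c : bool) (i j : 'I_n) : F := if c then OSy i j else OSx i j.

(* Convertible to [OS2_relation] for par = true and to [OS2p_relation] for
   par = false. *)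
Definition double_relation (f : F) : Prop :=
  [\/ supercommutator (fun=> par) f,
      (if par then symmetry_relation f else antisymmetry_relation f)
    | OS_relation f].

(* Explicit proof terms: rewriting would compare distinct elements of the free
   algebra up to conversion, which is slow. *)
Section Morphism.
Variables (R : pzRingType) (h : F -> R).
Hypotheses (hD : {morph h : f g / f + g}) (hN : {morph h : f / - f}).
Hypotheses (hM : {morph h : f g / f * g}) (h1 : h 1 = 1).
Let z c i j := h (OSxy c i j).

Lemma morph_signed_commutator (s : bool) a b :
  h (a * b - (-1) ^+ s * (b * a)) = h a * h b - (-1) ^+ s * (h b * h a).
Proof.
have h_sign : h ((-1) ^+ s) = (-1) ^+ s.
  by case: s; [apply: etrans (hN 1) (congr1 -%R h1)|apply: h1].
apply: etrans (hD _ _) (congr2 +%R (hM _ _) (etrans (hN _) _)).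
congr (- _); exact: etrans (hM _ _) (congr2 *%R h_sign (hM _ _)).
Qed.

Lemma morph_add3 a b c d e f :
  h (a * b + c * d + e * f) = h a * h b + h c * h d + h e * h f.
Proof.
exact: etrans (hD _ _) (congr2 +%R (etrans (hD _ _)
  (congr2 +%R (hM _ _) (hM _ _))) (hM _ _)).
Qed.

Lemma morph_xxx i j k : h (OSx i j * OSx j k + OSx j k * OSx k i
  + OSx k i * OSx i j) = triangle z false false i j k.
Proof. exact: morph_add3. Qed.

Lemma morph_yyy i j k : h (OSy i j * OSy j k + OSy j k * OSy k i
  + OSy k i * OSy i j) = triangle z true true i j k.
Proof. exact: morph_add3. Qed.

Lemma morph_xy i j k : h (OSx i j * OSy j k + OSx j k * OSy k i
    + OSx k i * OSy i j + OSy i j * OSx j k + OSy j k * OSx k i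
    + OSy k i * OSx i j)
  = triangle z false true i j k + triangle z true false i j k.
Proof.
rewrite /triangle !addrA.
exact: etrans (hD _ _) (congr2 +%R (etrans (hD _ _) (congr2 +%R (etrans (hD _ _)
  (congr2 +%R (morph_add3 _ _ _ _ _ _) (hM _ _))) (hM _ _))) (hM _ _)).
Qed.

End Morphism.

Lemma OSxyE c i j (ij : i != j) :
  OSxy c i j = fgen rat ((c, Sub (i, j) ij) : OSgen n).
Proof. by rewrite /OSxy /OSx /OSy; case: c; rewrite insubT. Qed.

Lemma OSxy_homogeneous c i j : homogeneous (fun=> par) par (OSxy c i j).
Proof.
move=> u; have [<-|ij] := eqVneq i j.
  by rewrite /OSxy /OSx /OSy insubF ?eqxx //; case: c; rewrite msupp0.
rewrite OSxyE /fgen msuppU oner_eq0 inE => /eqP->.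
by rewrite /word_parity fmU /= addn0; case: par.
Qed.

Section Evaluate.
Variables (m : nat) (z : bool -> 'I_n -> 'I_n -> 'M[rat]_m.+1).
Hypothesis zP : os_family par z.

Definition eval_matrix : F -> 'M[rat]_m.+1 :=
  eval_free (fun g : OSgen n => z g.1 (val g.2).1 (val g.2).2).
Local Notation ev := eval_matrix.

Lemma eval_OSxy c i j : i != j -> ev (OSxy c i j) = z c i j.
Proof. by move=> ij; rewrite OSxyE /ev eval_fgen. Qed.

Lemma eval_monomial f :
  forest f -> ev (forest_monomial OSxy f) = forest_monomial z f.
Proof.
move=> ff; rewrite /forest_monomial.
rewrite (big_morph ev (eval_freeM _) (eval_free1 _)); apply: eq_bigr => i _.
case fi: (f i) => [j|]; last exact: eval_free1.
have ij := forest_neq ff fi; rewrite /tinted /ev eval_freeD.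
rewrite -scaler_nat eval_freeZ scaler_nat.
by rewrite -/ev !eval_OSxy.
Qed.

Lemma eval_relation f : double_relation f -> ev f = 0.
Proof.
pose y c i j := ev (OSxy c i j).
have yE c i j : i != j -> y c i j = z c i j by apply: eval_OSxy.
have tri c d i j k : uniq [:: i; j; k] ->
    triangle y c d i j k = triangle z c d i j k.
  rewrite /= !inE negb_or !andbT => /andP[/andP[ij ik] jk].
  have ki : k != i by rewrite eq_sym.
  by rewrite /triangle !yE.
have sub a b : ev (a - b) = ev a - ev b.
  exact: etrans (eval_freeD _ _ _) (congr2 +%R (erefl _) (eval_freeN _ _)).
have sq c d i j : i != j -> ev (OSxy c i j * OSxy d i j) = 0.
  move=> ij; apply: etrans (eval_freeM _ _ _) _.
  exact: etrans (congr2 *%R (yE c i j ij) (yE d i j ij)) (os_sq zP _ _ ij).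
have sym c i j : i != j -> y c j i = - ((-1) ^+ par * y c i j).
  move=> ij; have ji : j != i by rewrite eq_sym.
  by rewrite !yE // (os_sym zP _ ij).
case.
- case=> p q a b ap bq; apply: etrans (morph_signed_commutator (eval_freeD _)
    (eval_freeN _) (eval_freeM _) (eval_free1 _) _ _ _) _.
  rewrite (eval_free_comm _ ap bq) ?subrr // => g h.
  exact: os_comm zP _ _ _ _ _ _.
- have sym_even c i j : par = false -> i != j -> y c i j + y c j i = 0.
    by move=> E ij; rewrite (sym c i j ij) E mul1r subrr.
  have sym_odd c i j : par = true -> i != j -> y c i j - y c j i = 0.
    by move=> E ij; rewrite (sym c i j ij) E mulN1r opprK subrr.
  case E: par => -[] i j ij.
  + exact: etrans (sub _ _) (sym_odd false i j E ij).
  + exact: etrans (sub _ _) (sym_odd true i j E ij).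
  + exact: etrans (eval_freeD _ _ _) (sym_even false i j E ij).
  + exact: etrans (eval_freeD _ _ _) (sym_even true i j E ij).
case=> [i j k u|i j k u|i j k u|i j ij|i j ij|i j ij].
- apply: etrans (morph_xxx (eval_freeD _) (eval_freeM _) i j k) _.
  by apply: add_self_eq0; rewrite tri //; apply: (os_triangle zP).
- apply: etrans (morph_xy (eval_freeD _) (eval_freeM _) i j k) _.
  by rewrite !tri //; apply: (os_triangle zP).
- apply: etrans (morph_yyy (eval_freeD _) (eval_freeM _) i j k) _.
  by apply: add_self_eq0; rewrite tri //; apply: (os_triangle zP).
- exact: (sq false false).
- exact: (sq false true).
- exact: (sq true true).
Qed.

Lemma eval_ideal f : ideal2 double_relation f -> ev f = 0.
Proof.
elim=> {f} [f /eval_relation //||f g _ f0 _ g0|f g _ g0|f g _ f0].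
- exact: eval_free0.
- by rewrite [LHS]eval_freeD [X in X + _]f0 add0r.
- by rewrite [LHS]eval_freeM [X in _ * X]g0 mulr0.
- by rewrite [LHS]eval_freeM [X in X * _]f0 mul0r.
Qed.

End Evaluate.

Variable proper : ~ ideal2 double_relation 1.
Local Notation Q := (quotalg proper).
Local Notation pi := (@quotalg_pi _ _ _ proper).

Definition OSclass c i j : Q := pi (OSxy c i j).

Lemma pi_add f g : pi (f + g) = pi f + pi g. Proof. exact: quotalg_piD. Qed.
Lemma pi_mul f g : pi (f * g) = pi f * pi g. Proof. exact: quotalg_piM. Qed.
Lemma pi_scale a f : pi (a *: f) = a *: pi f. Proof. exact: quotalg_piZ. Qed.
Lemma pi_zero : pi 0 = 0.
Proof. by have := pi_scale 0 0; rewrite !scale0r. Qed.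
Lemma pi_opp f : pi (- f) = - pi f.
Proof. by rewrite -!scaleN1r pi_scale. Qed.

Lemma pi_eq0 f : pi f = 0 <-> ideal2 double_relation f.
Proof. by rewrite -pi_zero quotalg_piP subr0. Qed.

Lemma OSclass_family : os_family par OSclass.
Proof.
have rel f : double_relation f -> pi f = 0 by move=> ?; apply/pi_eq0/Ideal2_gen.
have OSrel f : OS_relation f -> pi f = 0 by move=> ?; apply/rel/Or33.
have comm c d i j k l : OSclass c i j * OSclass d k l
    = (-1) ^+ par * (OSclass d k l * OSclass c i j).
  (* Writing the exponent as [par && par] exhibits a supercommutator of two elements of parity
     [par]. *)
  apply/eqP; rewrite -subr_eq0 -[in _ ^+ _](andbb par); apply/eqP.
  apply: etrans (esym (morph_signed_commutator pi_add pi_opp pi_mul (erefl _)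
    _ _ _)) (rel _ (Or31 _ _ _)).
  by constructor; apply: OSxy_homogeneous.
split=> //.
- move=> c i j ij.
  have : (if par then symmetry_relation (OSxy c i j - OSxy c j i)
     else antisymmetry_relation (OSxy c i j + OSxy c j i)).
    by case: par c => -[];
      [apply: Sym_y|apply: Sym_x|apply: Antisym_y|apply: Antisym_x].
  case E: par => H.
  + have pi0 : pi (OSxy c i j - OSxy c j i) = 0.
      by apply/rel/Or32; rewrite E.
    have /eqP : OSclass c i j - OSclass c j i = 0.
      exact: etrans (congr2 +%R (erefl _) (esym (pi_opp _)))
        (etrans (esym (pi_add _ _)) pi0).
    by rewrite subr_eq0 mulN1r opprK => /eqP.
  + have pi0 : pi (OSxy c i j + OSxy c j i) = 0.
      by apply/rel/Or32; rewrite E.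
    have /eqP : OSclass c i j + OSclass c j i = 0.
      exact: etrans (esym (pi_add _ _)) pi0.
    by rewrite addrC addr_eq0 mul1r => /eqP.
- move=> c d i j k u.
  have xx : triangle OSclass false false i j k = 0.
    exact: etrans (esym (morph_xxx pi_add pi_mul i j k)) (OSrel _ (OS_xxx u)).
  have yy : triangle OSclass true true i j k = 0.
    exact: etrans (esym (morph_yyy pi_add pi_mul i j k)) (OSrel _ (OS_yyy u)).
  have xy : triangle OSclass false true i j k
      + triangle OSclass true false i j k = 0.
    exact: etrans (esym (morph_xy pi_add pi_mul i j k)) (OSrel _ (OS_xy u)).
  case: c d => -[]; [| |exact: xy|].
  + exact: etrans (congr2 +%R yy yy) (addr0 _).
  + exact: etrans (addrC _ _) xy.
  + exact: etrans (congr2 +%R xx xx) (addr0 _).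
have sq c d i j : OS_relation (OSxy c i j * OSxy d i j) ->
    OSclass c i j * OSclass d i j = 0.
  by move/OSrel; apply: etrans; apply/esym/pi_mul.
move=> [] [] i j ij.
- exact/sq/OS_sq_y.
- by rewrite comm sq ?mulr0 //; apply: OS_mul_xy.
- exact/sq/OS_mul_xy.
- exact/sq/OS_sq_x.
Qed.

(** By induction on words: the empty word is the monomial of the empty forest, and [spanned_gen]
    absorbs each further letter. *)
Lemma quotalg_spanned (r : Q) : forest_spanned OSclass r.
Proof.
rewrite -[r]quotalg_reprK; move: (quotalg_repr r) => f.
rewrite (monalgE f); elim/big_ind: _ => [|a b|u _].
- by rewrite pi_zero; apply: spanned0.
- by rewrite pi_add; apply: spannedD.
have -> : << f@_u *g u >> = f@_u *: (<< u >> : F).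
  by apply/malgP=> v; rewrite mcoeffZ 2!mcoeffU mulr_natr.
rewrite pi_scale; apply: spannedZ; case: u => s.
elim: s => [|[c [[i j] ij]] s IHs].
  have -> : (<< FMonom [::] >> : F) = 1 by rewrite -fmoneE.
  have -> : pi 1 = forest_monomial OSclass [ffun=> None].
    by rewrite /forest_monomial big1 // => v _; rewrite ffunE.
  exact/spanned_mono/forest0.
have -> : (<< FMonom ((c, exist _ (i, j) ij) :: s) >> : F)
    = OSxy c i j * << FMonom s >>.
  rewrite (OSxyE c ij) /fgen [RHS]fgmulUU mulr1 fmuE; congr << _ >>.
  by rewrite -[RHS]/(fmmul _ _) fmmulE.
by rewrite pi_mul; apply: (spanned_gen OSclass_family).
Qed.

Lemma pi_monomial f : pi (forest_monomial OSxy f) = forest_monomial OSclass f.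
Proof.
rewrite /forest_monomial (big_morph pi pi_mul (erefl 1)); apply: eq_bigr => i _.
case: (f i) => [j|//]; rewrite /tinted pi_add; congr (_ + _).
by rewrite -!scaler_nat pi_scale.
Qed.

(** A relation among the classes lifts to an element of the ideal, which evaluates to 0 in every
    matrix family; hence its coefficients are [vanishing]. *)
Lemma quotalg_free (c : {ffun 'I_n -> option 'I_n} -> rat) :
  \sum_(f | forest f) c f *: forest_monomial OSclass f = 0 ->
  forall f, forest f -> c f = 0.
Proof.
(* Size 0 is separate: evaluation takes values in an algebra with [1 != 0], hence in matrices of
   size [m.+1]. *)
move=> c0; apply: (@vanishing_eq0 n par) => -[|m] z zP; first exact: flatmx0.
have : ideal2 double_relation
    (\sum_(f | forest f) c f *: forest_monomial OSxy f).
  apply/pi_eq0; rewrite -[RHS]c0 (big_morph pi pi_add pi_zero).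
  by apply: eq_bigr => f _; rewrite pi_scale pi_monomial.
move=> /(eval_ideal zP) ev0; rewrite -[RHS]ev0.
rewrite (big_morph (eval_matrix z) (eval_freeD _) (eval_free0 _)).
apply: eq_bigr => f ff; rewrite -(eval_monomial z ff).
by rewrite [RHS]eval_freeZ.
Qed.

Lemma quotalg_dim : (0 < n)%N -> has_dim Q (n.+1 ^ n.-1)%N.
Proof.
move=> n_gt0; have := @card_forests 'I_n;
  rewrite card_ord cardsE => /(_ n_gt0) <-.
apply: has_dim_basis quotalg_free; exact: quotalg_spanned.
Qed.

End DoubleOrlikSolomon.

Theorem theorem2 (n : nat) (n_ge1 : (1 <= n)%N) :
  has_dim (OS2 n) ((n + 1) ^ (n - 1))%N /\
  has_dim (OS2p n) ((n + 1) ^ (n - 1))%N.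
Proof.
rewrite addn1 subn1; split.
- exact: (@quotalg_dim n true (@OS2_proper n)).
- exact: (@quotalg_dim n false (@OS2p_proper n)).
Qed.
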